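(* Let $m\in\{2,3,4\}$, let $a,b,c\in\mathbb{Z}$ be such that $f(x)=x^6+ax^m+bx+c$ is irreducible over $\mathbb{Q}$, and let $K=\mathbb{Q}(\theta)$ where $\theta$ is a root of $f(x)$. Suppose that $a+(-1)^m$, $b$ and $c$ are divisible by $9$, and that $m\,v_3(b)<(m-1)\,v_3(c)$. Then: (i) if $m=2$, then $v_3(i(K))=1$; (ii) if $m=3$ and $\gcd(v_3(b),2)=1$, then $v_3(i(K))=1$; (iii) if $m=4$ and $\gcd(v_3(b),3)=1$, then $v_3(i(K))=1$. In particular, in each of these cases $K$ is non-monogenic.
   Context: $O_K$ denotes the ring of algebraic integers of $K$. For $\alpha\in O_K$, $\operatorname{ind}\alpha$ denotes the index of the subgroup $\mathbb{Z}[\alpha]$ in $O_K$. The index of the field is $i(K)=\gcd\{\operatorname{ind}\alpha : \alpha\in O_K,\ K=\mathbb{Q}(\alpha)\}$. For a rational prime $p$ and an integer $r$, $v_p(r)$ is the exponent of the highest power of $p$ dividing $r$. $K$ is monogenic if $O_K=\mathbb{Z}[\alpha]$ for some $\alpha\in O_K$, and non-monogenic otherwise. *)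

(* Defs.v *)
From mathcomp Require Import all_boot all_order all_algebra all_field.
From mathcomp Require Import finmap.
From mathcomp Require Import boolp classical_sets cardinality.

Set Implicit Arguments.
Unset Strict Implicit.
Unset Printing Implicit Defensive.

Import GRing.Theory.
Local Open Scope ring_scope.
Local Open Scope classical_set_scope.

Definition cosets (V : zmodType) (A B : set V) : set (set V) :=
  [set [set x + z | z in B] | x in A].

(* Index of the additive subgroup B in A, as the number of cosets x + B with
   x in A; 0 when there are infinitely many cosets (as fset_set is then
   empty). *)
Definition add_index (V : zmodType) (A B : set V) : nat :=
  (#|` fset_set (cosets A B)|)%fset.

(* The gcd of a possibly infinite set of naturals: the greatest common divisor
   for divisibility, so 0 is neutral and gcd_set set0 = 0. *)
Definition is_gcd_set (S : set nat) (d : nat) : Prop :=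
  (forall n, S n -> (d %| n)%N) /\
  (forall e : nat, (forall n, S n -> (e %| n)%N) -> (e %| d)%N).

Definition gcd_set (S : set nat) : nat := xget 0%N (is_gcd_set S).

Definition ring_of_integers (K : fieldExtType rat) : set K :=
  [set x | integralOver (intr : int -> K) x].

Definition Zadjoin (K : fieldExtType rat) (alpha : K) : set K :=
  [set (map_poly intr p).[alpha] | p in [set: {poly int}]].

Definition ind (K : fieldExtType rat) (alpha : K) : nat :=
  add_index (@ring_of_integers K) (Zadjoin alpha).

Definition field_index (K : fieldExtType rat) : nat :=
  gcd_set [set ind alpha | alpha in
    [set alpha : K | ring_of_integers alpha /\
                     <<1; alpha>>%VS = fullv :> {vspace K}]].

Definition monogenic (K : fieldExtType rat) : Prop :=
  exists2 alpha : K, ring_of_integers alpha &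
    @ring_of_integers K = Zadjoin alpha.

(* Only meaningful for r <> 0: logn p 0 = 0, whereas the p-adic valuation of 0
   is infinite. Hence an inequality between valuations that forces the smaller
   one to be finite must be accompanied by the nonvanishing of its argument. *)
Definition vp (p : nat) (r : int) : nat := logn p `|r|%N.

Definition sextic (m : nat) (a b c : int) : {poly int} :=
  'X^6 + a *: 'X^m + b *: 'X + c%:P.

(* Main.v *)
Require Import Defs.
From mathcomp Require Import all_boot all_order all_algebra all_field.
From mathcomp Require Import all_fingroup all_solvable.
From mathcomp Require Import finmap boolp classical_sets cardinality.
From mathcomp Require Import ring zify.

Set Implicit Arguments.
Unset Strict Implicit.
Unset Printing Implicit Defensive.

Import GRing.Theory Num.Theory.
Local Open Scope ring_scope.

(** Over Z_3 the sextic has, besides the linear factor given by the first side of its Newton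
    polygon at 0, a factor of residue degree one at 0 and two more at the nonzero residues (1 and
    -1, or twice -1 when m = 3). Hence exactly four primes of K above 3 have degree one, whereas
    F_3 has three elements: any algebraic integer alpha takes the same value under two of the
    four homomorphisms O_K -> F_3, so Z[alpha] is contained in the kernel of their difference and
    3 divides ind alpha; in particular K is not monogenic.

    The homomorphisms are read off an explicit order L, spanned by the elements attached to the
    Newton polygons, whose multiplication table is reduced mod 3. If y = 3 x lies in L with x
    integral, then y is nilpotent mod 3 L, which puts y in the radical; uniformizers of the
    ramified primes then force y in 3 L, so L is the ring of integers locally at 3.

    Finally let a0 in L take the same value at two unramified primes i and j only, and be a
    uniformizer up to a translation at the ramified ones. Modulo 3 L the powers of a0 satisfy only
    the multiples of one quintic relation T. One of a0 and a0 + 3 e, with e separating i from j,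
    satisfies T(a) = 3 x with x different at i and j (or no x at all), and then Z[a] is the
    subring of L where i and j agree, up to an index prime to 3: its 3-index is exactly 3. *)

(** * Traces and denominators of integral elements *)

(** The hypotheses describe polygons. At 0 the vertices are (0, v_3(c)), (1, v_3(b)) and (m, 0): the
    inequality between valuations puts the middle point below the segment joining the other two,
    whence the linear factor, and v_3(b) prime to m - 1 makes the other side totally ramified of
    index m - 1. Modulo 3 the sextic is X^2 (X - 1)(X + 1)(X^2 + 1), X^3 (X + 1)^3 or X^4 (X - 1)(X
    + 1) for m = 2, 3, 4. For m = 3 the congruences modulo 9 matter at -1: the constant coefficient
    in X + 1 has valuation at least 2, the linear one exactly 1 and the cubic one 0, so that (X +
    1)^3 again lifts to a linear factor times a ramified quadratic one. Neither completions nor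
    prime ideals are used. A prime of degree one is a row of values in F_3 on six generators, and
    valuations are read from identities such as pi^2 = 3 tau with tau nonzero in the row. The local
    analysis thus becomes polynomial identities between structure constants together with linear
    algebra over F_3. *)

Section Trace.
Context (K : fieldExtType rat).
Local Notation n := (\dim {:K}).
Local Notation X := (vbasis {:K}).

Definition mulmat (x : K) : 'M[rat]_n := \matrix_(i, j) coord X j (x * X`_i).

Lemma coordsE (x : K) : x = \sum_(i < n) coord X i x *: X`_i.
Proof. exact: coord_vbasis (memvf x). Qed.

Lemma mulmatD x y : mulmat (x + y) = mulmat x + mulmat y.
Proof. by apply/matrixP=> i j; rewrite !mxE mulrDl linearD. Qed.

Lemma mulmatZ a x : mulmat (a *: x) = a *: mulmat x.
Proof. by apply/matrixP=> i j; rewrite !mxE -scalerAl linearZ. Qed.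

Lemma mulmat1 : mulmat 1 = 1%:M.
Proof.
by apply/matrixP=> i j; rewrite !mxE mul1r coord_free ?(basis_free (vbasisP _)) 1?eq_sym.
Qed.

Lemma mulmatM x y : mulmat (x * y) = mulmat x *m mulmat y.
Proof.
apply/matrixP=> i j; rewrite !mxE mulrAC {1}[x * _]coordsE.
rewrite mulr_suml linear_sum /=; apply: eq_bigr => k _.
by rewrite !mxE -scalerAl linearZ /= [_ * y]mulrC.
Qed.

Definition trK (x : K) : rat := \tr (mulmat x).

Lemma trKD x y : trK (x + y) = trK x + trK y.
Proof. by rewrite /trK mulmatD mxtraceD. Qed.

Lemma trKZ a x : trK (a *: x) = a * trK x.
Proof. by rewrite /trK mulmatZ mxtraceZ. Qed.

Lemma trK1 : trK 1 = n%:R.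
Proof. by rewrite /trK mulmat1 mxtrace1. Qed.

Lemma trK_sum (m : nat) (c : 'I_m -> rat) (F : 'I_m -> K) :
  trK (\sum_i c i *: F i) = \sum_i c i * trK (F i).
Proof.
elim: m c F => [|m IH] c F.
  by rewrite !big_ord0 -(scale0r 0) trKZ mul0r.
by rewrite !big_ord_recl trKD trKZ IH.
Qed.

Lemma dimK_gt0 : (0 < n)%N.
Proof.
rewrite lt0n dimv_eq0; apply/negP=> /eqP K0.
by have := memvf (1 : K); rewrite K0 memv0 oner_eq0.
Qed.

(** Over [algC] every eigenvalue of multiplication by x is a root of the integral equation of x,
    hence an algebraic integer. The trace is their sum, and a rational algebraic integer is an
    integer. *)
Lemma trK_int (x : K) : integralOver (intr : int -> K) x -> trK x \is a Num.int.
Proof.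
case=> h hmon /rootP hx.
pose N y : 'M[algC]_n := map_mx ratr (mulmat y).
have [r Er] := closed_field_poly_normal (char_poly (N x)).
rewrite (monicP (char_poly_monic _)) scale1r in Er.
have sr : size r = n.
  by have := size_char_poly (N x); rewrite Er size_prod_XsubC => -[].
have ev l : l \in r -> l \in Aint.
  move=> lr.
  have : eigenvalue (N x) l by rewrite eigenvalue_root_char Er root_prod_XsubC.
  case/eigenvalueP=> v vN v0.
  have hl : v *m N ((map_poly intr h).[x]) = (map_poly intr h).[l] *: v.
    elim/poly_ind: (h) => [|g c IH].
      rewrite !rmorph0 !horner0 scale0r /N -(scale0r (0 : K)) mulmatZ scale0r.
      by rewrite map_mx0 mulmx0.
    rewrite !rmorphD !rmorphM /= !map_polyX !map_polyC !hornerMXaddC /=.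
    rewrite /N mulmatD map_mxD mulmxDr mulmatM map_mxM mulmxA -/(N _) IH.
    rewrite -scalemxAl -/(N _) vN scalerA scalerDl; congr (_ + _).
    rewrite -[c%:~R](mulr1) mulrzl -scaler_int mulmatZ mulmat1 map_mxZ map_mx1.
    by rewrite -scalemxAr mulmx1 /= rmorph_int.
  have N0 : N 0 = 0 by rewrite /N -(scale0r (0 : K)) mulmatZ scale0r map_mx0.
  rewrite hx N0 mulmx0 in hl.
  have /root_monic_Aint : root (map_poly intr h) l.
    by move/esym/eqP: hl; rewrite scaler_eq0 (negPf v0) orbF.
  apply; first by rewrite monic_map.
  by apply/polyOverP=> i; rewrite coef_map /= rpred_int.
have tr_r : (ratr (trK x) : algC) = \sum_(l <- r) l.
  have := char_poly_trace (N x) dimK_gt0.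
  rewrite Er -[in n.-1]sr coefPn_prod_XsubC ?sr -?lt0n ?dimK_gt0 // => /oppr_inj ->.
  by rewrite /N trace_map_mx.
have : (ratr (trK x) : algC) \is a Num.int.
  apply: Cint_rat_Aint; first exact: Crat_rat.
  rewrite tr_r big_seq; exact: rpred_sum ev.
move=> /intrP [m hm]; apply/intrP; exists m.
apply: (fmorph_inj (ratr : {rmorphism rat -> algC})).
by rewrite /= hm rmorph_int.
Qed.

(** The trace form is nondegenerate: if y is orthogonal to the basis and nonzero, the trace of y
    y^-1 = 1 is both 0 and the degree. The traces of an integral x against the basis being integers,
    Cramer's rule shows that the determinant of the Gram matrix clears the denominators of its
    coordinates. *)
Lemma denominator_bound (w : n.-tuple K) : basis_of {:K} w ->
  (forall i : 'I_n, integralOver (intr : int -> K) w`_i) ->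
  exists2 D : int, D != 0 &
    forall x, integralOver (intr : int -> K) x ->
    forall j, D%:~R * coord w j x \is a Num.int.
Proof.
move=> wB wint.
have wE x : x = \sum_j coord w j x *: w`_j by apply: coord_basis (memvf x).
pose G' : 'M[int]_n := \matrix_(i, j) numq (trK (w`_i * w`_j)).
have GE : map_mx intr G' = \matrix_(i, j) trK (w`_i * w`_j).
  apply/matrixP=> i j; rewrite !mxE.
  have /numqK // := trK_int (integral_mul (wint i) (wint j)).
exists (\det G').
  apply/negP; rewrite -(intr_eq0 rat) -[_%:~R]/(intr _) -det_map_mx GE.
  case/det0P => v v0 vG.
  pose y := \sum_j v 0 j *: w`_j.
  have y0 : y != 0.
    apply: contra v0 => /eqP y0; apply/eqP/rowP=> j.
    by rewrite mxE -(coord_sum_free (v 0) j (basis_free wB)) -/y y0 linear0.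
  have tw (j : 'I_n) : trK (y * w`_j) = 0.
    move/rowP/(_ j): vG; rewrite !mxE /y mulr_suml => <-.
    under eq_bigr do rewrite -scalerAl.
    by rewrite trK_sum; apply: eq_bigr => i _; rewrite mxE.
  have : trK (y * y^-1) = 0.
    rewrite [y^-1]wE mulr_sumr; under eq_bigr do rewrite -scalerAr.
    by rewrite trK_sum big1 // => i _; rewrite tw mulr0.
  rewrite divff // trK1 => /eqP; rewrite pnatr_eq0 => /eqP h.
  by have := dimK_gt0; rewrite h.
move=> x xint j.
pose c : 'rV[rat]_n := \row_j coord w j x.
have cG i : (c *m map_mx intr G') 0 i = trK (x * w`_i).
  rewrite GE mxE [in RHS](wE x) mulr_suml.
  under [in RHS]eq_bigr do rewrite -scalerAl.
  by rewrite trK_sum; apply: eq_bigr => k _; rewrite !mxE.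
have -> : (\det G')%:~R * coord w j x = (c *m map_mx intr G' *m map_mx intr (\adj G')) 0 j.
  by rewrite -mulmxA -map_mxM mul_mx_adj map_scalar_mx mul_mx_scalar !mxE.
rewrite mxE; apply: rpred_sum => i _; apply: rpredM.
  by rewrite cG; apply: trK_int; apply: integral_mul.
by rewrite mxE rpred_int.
Qed.
End Trace.

(** * The index as the order of a finite group *)

Definition Zspan (V : zmodType) (n : nat) (w : 'I_n -> V) (x : V) : Prop :=
  exists z : 'I_n -> int, x = \sum_i w i *~ z i.

Lemma Zspan0 (V : zmodType) n (w : 'I_n -> V) : Zspan w 0.
Proof. by exists (fun=> 0); rewrite big1 // => i _; rewrite mulr0z. Qed.

Lemma ZspanB (V : zmodType) n (w : 'I_n -> V) x y :
  Zspan w x -> Zspan w y -> Zspan w (x - y).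
Proof.
move=> [z ->] [z' ->]; exists (fun i => z i - z' i).
by rewrite -sumrB; apply: eq_bigr => i _; rewrite mulrzBr.
Qed.

Lemma ZspanN (V : zmodType) n (w : 'I_n -> V) x : Zspan w x -> Zspan w (- x).
Proof. by move=> h; rewrite -sub0r; apply: ZspanB => //; apply: Zspan0. Qed.

Lemma ZspanD (V : zmodType) n (w : 'I_n -> V) x y :
  Zspan w x -> Zspan w y -> Zspan w (x + y).
Proof. by move=> hx hy; rewrite -[y]opprK; apply: ZspanB => //; apply: ZspanN. Qed.

Lemma Zspan_mulz (V : zmodType) n (w : 'I_n -> V) x (k : int) :
  Zspan w x -> Zspan w (x *~ k).
Proof.
move=> [z ->]; exists (fun i => z i * k).
by rewrite mulrz_suml; apply: eq_bigr => i _; rewrite mulrzA.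
Qed.

Lemma Zspan_gen (V : zmodType) n (w : 'I_n -> V) i : Zspan w (w i).
Proof.
exists (fun j => (j == i)%:R); rewrite (bigD1 i) //= eqxx mulr1z big1 ?addr0 // => j /negPf ->.
by rewrite mulr0z.
Qed.

Lemma Zspan_sum (V : zmodType) n (w : 'I_n -> V) (I : Type) (r : seq I) (P : pred I) F :
  (forall i, P i -> Zspan w (F i)) -> Zspan w (\sum_(i <- r | P i) F i).
Proof.
move=> h; elim/big_ind: _ => //; first exact: Zspan0.
exact: ZspanD.
Qed.

Lemma Zp_intr_eq0 (D : nat) (z : int) : (1 < D)%N ->
  (z%:~R == 0 :> 'Z_D) = (D%:Z %| z)%Z.
Proof.
move=> D1; have nat0 (k : nat) : (k%:R == 0 :> 'Z_D) = (D %| k)%N.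
  by rewrite -val_eqE /= val_Zp_nat.
case: z => k; first by rewrite -[(_%:~R : 'Z_D)]/(k%:R) nat0.
by rewrite NegzE mulrNz oppr_eq0 dvdzE abszN -[(_%:~R : 'Z_D)]/(k.+1%:R) nat0.
Qed.

Section LatticeIndex.
Context (K : fieldExtType rat) (n : nat) (w : n.-tuple K) (wB : basis_of {:K} w).
Local Notation B := (Zspan (fun i : 'I_n => w`_i)).
Context (A : set K) (A0 : A 0) (AB : forall x y, A x -> A y -> A (x - y)).
Context (BA : forall x, B x -> A x) (D : nat) (D1 : (1 < D)%N).
Context (hD : forall x, A x -> B (x *+ D)).

Local Notation V := ('rV['Z_D]_n).
(** Since D A lies in B, the coordinates of D x modulo D identify A / B with a subgroup of (Z/D)^n;
    [rep] is a section. This realizes the quotient as a finite group. *)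
Definition cls (x : K) : V := \row_i (numq (coord w i (x *+ D)))%:~R.
Definition rep (v : V) : K := D%:R^-1 *: \sum_(i < n) w`_i *~ (v 0 i : nat).

Local Lemma coordZ (z : 'I_n -> int) (i : 'I_n) : coord w i (\sum_(j < n) w`_j *~ z j) = (z i)%:~R.
Proof.
under eq_bigr do rewrite -scaler_int.
exact: (coord_sum_free (fun j => (z j)%:~R) i (basis_free wB)).
Qed.

Local Lemma clsE x z : x *+ D = \sum_(j < n) w`_j *~ z j -> cls x = \row_i (z i)%:~R.
Proof. by move=> h; apply/rowP=> i; rewrite !mxE h coordZ numq_int. Qed.

Local Lemma clsB x y : A x -> A y -> cls (x - y) = cls x - cls y.
Proof.
move=> /hD [z hz] /hD [z' hz'].
rewrite (clsE hz) (clsE hz') (@clsE _ (fun i => z i - z' i)).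
  by apply/rowP=> i; rewrite !mxE rmorphB.
by rewrite mulrnBl hz hz' -sumrB; apply: eq_bigr => i _; rewrite mulrzBr.
Qed.

Local Lemma D0 : (D%:R : rat) != 0.
Proof. by rewrite pnatr_eq0 -lt0n ltnW. Qed.

Local Lemma cls0P x : A x -> reflect (B x) (cls x == 0).
Proof.
move=> Ax; apply: (iffP eqP); have [z hz] := hD Ax; rewrite (clsE hz).
  move=> /rowP h.
  have dv i : (D%:Z %| z i)%Z by rewrite -Zp_intr_eq0 //; have := h i; rewrite !mxE => ->.
  exists (fun i => (z i %/ D%:Z)%Z).
  suff : (D%:R : rat) *: x = (D%:R : rat) *: \sum_(i < n) w`_i *~ (z i %/ D)%Z.
    by move/(scalerI D0).
  rewrite !scaler_nat hz -sumrMnl; apply: eq_bigr => i _.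
  by rewrite pmulrn -mulrzA divzK.
move=> [u hu]; apply/rowP=> i; rewrite !mxE; apply/eqP; rewrite Zp_intr_eq0 //.
have : coord w i (x *+ D) = (z i)%:~R by rewrite hz coordZ.
rewrite linearMn /= hu coordZ -mulr_natr -[D%:R]/(D%:Z%:~R) -intrM => /intr_inj <-.
exact: dvdz_mull.
Qed.

Local Lemma repK v : cls (rep v) = v.
Proof.
rewrite (@clsE _ (fun i => (v 0 i : nat)%:Z)).
  by apply/rowP=> i; rewrite !mxE -[LHS]/((v 0 i : nat)%:R) natr_Zp.
by rewrite /rep -scaler_nat scalerA mulfV ?D0 ?scale1r.
Qed.

Local Lemma clsK x : A x -> B (x - rep (cls x)).
Proof.
move=> /hD [z hz]; rewrite (clsE hz) /rep.
have Dz0 : D%:Z != 0 by rewrite eqz_nat -lt0n ltnW.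
exists (fun i => (z i %/ D%:Z)%Z).
apply: (scalerI D0); rewrite scalerBr scalerA mulfV ?D0 ?scale1r //.
rewrite !scaler_nat hz -sumrMnl -sumrB; apply: eq_bigr => i _.
rewrite pmulrn -mulrzA -mulrzBr mxE; congr (_ *~ _).
have mE : (z i %% D)%Z = `|(z i %% D)%Z|%:Z by rewrite gez0_abs ?modz_ge0.
have -> : ((z i)%:~R : 'Z_D) = `|(z i %% D)%Z|%:R.
  rewrite {1}(divz_eq (z i) D) rmorphD rmorphM /= -[(D%:Z%:~R)]/(D%:R) pchar_Zp // mulr0 add0r.
  by rewrite {1}mE.
rewrite val_Zp_nat // modn_small; first by rewrite {1}(divz_eq (z i) D) {1}mE addrK.
by rewrite -ltz_nat -mE ltz_pmod // ltz_nat ltnW.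
Qed.

Local Lemma Arep x : A x -> A (rep (cls x)).
Proof. by move=> Ax; have -> : rep (cls x) = x - (x - rep (cls x)); [rewrite subKr | apply: AB => //; apply: BA; apply: clsK]. Qed.

Definition clsset : {set V} := [set v : V | `[< A (rep v) >]].

Lemma clssetP v : reflect (A (rep v)) (v \in clsset).
Proof. by rewrite finset.in_set; apply: asboolP. Qed.

Local Lemma clsset_cls x : A x -> cls x \in clsset.
Proof. by move=> Ax; apply/clssetP; apply: Arep. Qed.

Local Lemma clsset_group : group_set clsset.
Proof.
have B' v v' : v \in clsset -> v' \in clsset -> v - v' \in clsset.
  move=> /clssetP Av /clssetP Av'.
  have -> : v - v' = cls (rep v - rep v') by rewrite clsB // !repK.
  exact: clsset_cls (AB Av Av').
have h0 : (0 : V) \in clsset.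
  have -> : (0 : V) = cls 0; last exact: clsset_cls.
  by apply/esym/eqP/cls0P => //; apply: Zspan0.
apply/group_setP; split=> [|v v' hv hv']; first exact: h0.
rewrite -[(v * v')%g]/(v + v') -[v']opprK; apply: (B') => //.
by rewrite -sub0r; apply: B'.
Qed.

Definition clsgroup : {group V} := Group clsset_group.

Lemma add_index_cls : add_index A B = #|clsgroup|.
Proof.
pose F v : set K := [set rep v + z | z in B]%classic.
have -> : #|clsgroup| = #|` [fset F v | v in clsset]%fset|.
  rewrite card_in_imfset /= => [|v v' hv hv']; first by rewrite cardE.
  move/clssetP in hv; move/clssetP in hv'.
  move=> /seteqP [h _]; have /h [z Bz hz] : F v (rep v) by exists 0; [apply: Zspan0 | rewrite addr0].
  apply/eqP; rewrite -subr_eq0 -(repK v) -(repK v') -clsB //.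
  by apply/cls0P; [apply: AB | rewrite -hz addrC addKr].
rewrite /add_index; congr (#|` _ |).
have -> : cosets A B = [set` [fset F v | v in clsset]%fset]%classic; last by rewrite set_fsetK.
apply/seteqP; split=> [C [x Ax <-]|C /= /imfsetP [v /=]].
  apply/imfsetP; exists (cls x) => /=; first exact: clsset_cls.
  have := clsK Ax; set y := rep _ => Bxy.
  apply/seteqP; split=> u [z Bz <-].
    by exists ((x - y) + z); [apply: ZspanD | rewrite [x - y]addrC !addrA subrr add0r].
  by exists (z - (x - y)); [apply: ZspanB | rewrite opprB addrCA subrKC addrC].
by move=> /clssetP Av ->; exists (rep v).
Qed.

Lemma add_index_gt0 : (0 < add_index A B)%N.
Proof. by rewrite add_index_cls cardG_gt0. Qed.

Local Lemma Amuln x k : A x -> A (x *+ k).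
Proof.
move=> Ax; elim: k => [|k IH]; rewrite ?mulr0n // mulrSr -[x in _ + x]opprK.
by apply: AB => //; rewrite -sub0r; apply: AB.
Qed.

Local Lemma cls_muln x k : A x -> cls (x *+ k) = cls x *+ k.
Proof.
move=> Ax; have cls0 : cls 0 = 0 by apply/eqP/cls0P => //; apply: Zspan0.
elim: k => [|k IH]; first by rewrite !mulr0n.
have -> : x *+ k.+1 = x *+ k - (0 - x) by rewrite sub0r opprK mulrSr.
rewrite clsB ?clsB ?IH ?cls0 ?sub0r ?opprK ?mulrSr //; try exact: Amuln.
by rewrite -sub0r; apply: AB.
Qed.

(** Lagrange's theorem in [clsgroup]. *)
Lemma add_index_kills x : A x -> B (x *+ add_index A B).
Proof.
move=> Ax; apply/cls0P; first exact: Amuln.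
rewrite cls_muln //; have := @expg_cardG _ clsgroup (cls x) (clsset_cls Ax).
by rewrite FinRing.zmodXgE add_index_cls => ->.
Qed.

(** A Sylow p-subgroup of A / B consists of p-power torsion, on which [delta] is injective; having
    at most p elements, it has order 1 or p. Additivity of [delta] plays no part in this counting,
    only injectivity does. *)
Lemma logn_add_index_le1 (p : nat) (delta : K -> 'F_p) : prime p ->
  (forall k x y, A x -> A y -> B (x *+ p ^ k) -> B (y *+ p ^ k) ->
    delta x = delta y -> B (x - y)) ->
  (logn p (add_index A B) <= 1)%N.
Proof.
move=> pp hdelta; rewrite add_index_cls.
have [S sylS] := Sylow_exists p clsgroup.
have cS : #|S| = (p ^ logn p #|clsgroup|)%N by rewrite (card_Hall sylS) p_part.
have Av v : v \in S -> A (rep v).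
  by move=> /(fintype.subsetP (pHall_sub sylS)) /clssetP.
have torsion v : v \in S -> B (rep v *+ p ^ logn p #|clsgroup|).
  move=> vS; apply/cls0P; first exact/Amuln/Av.
  rewrite cls_muln ?repK; last exact: Av.
  by have := expg_cardG vS; rewrite FinRing.zmodXgE cS => ->.
rewrite -(leq_exp2l _ _ (prime_gt1 pp)) -cS expn1 -[in leqRHS](card_Fp pp).
rewrite -(card_in_imset (f := fun v => delta (rep v))) ?max_card // => v v' hv hv' e.
apply/eqP; rewrite -subr_eq0 -(repK v) -(repK v') -clsB; try exact: Av.
apply/cls0P; first by apply: AB; apply: Av.
exact: hdelta (Av _ hv) (Av _ hv') (torsion _ hv) (torsion _ hv') e.
Qed.
End LatticeIndex.

(** * Integral generators and the lattice Z[x] *)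

Section Powers.
Context (K : fieldExtType rat).
Local Notation n := (\dim {:K}).

(** Gauss's lemma: an integer multiple of the minimal polynomial divides the monic equation of x in
    Z[X], so its leading coefficient is 1 or -1, and scaling by that sign makes it monic. *)
Lemma monic_minimal_poly (x : K) : integralOver (intr : int -> K) x ->
  exists h : {poly int}, [/\ h \is monic, size h = (adjoin_degree 1 x).+1
    & root (map_poly intr h) x].
Proof.
case=> h hmon hx.
have /polyOver1P [q Eq] := minPolyOver 1%AS x.
have qh : q %| map_poly intr h.
  rewrite -(dvdp_map (in_alg K)) /= -Eq.
  have -> : map_poly (in_alg K) (map_poly intr h) = map_poly intr h.
    by rewrite -map_poly_comp; apply: eq_map_poly => z; rewrite /= scaler_int.
  apply: minPoly_dvdp => //.
  by apply/polyOverP=> i; rewrite coef_map rpred_int.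
have [q1 [a a0 Eq1] [r hr]] := dvdpP_rat_int qh.
have lr : lead_coef q1 * lead_coef r = 1 by rewrite -lead_coefM -hr (monicP hmon).
have l2 : lead_coef q1 * lead_coef q1 = 1.
  rewrite mulrC in lr; have := intUnitRing.unitzPl lr.
  by rewrite qualifE /= => /orP[] /eqP ->.
have q1root : root (map_poly intr q1) x.
  have := root_minPoly 1 x.
  rewrite Eq Eq1 -mul_polyC rmorphM /= map_polyC rootM /root hornerC /= scaler_eq0.
  rewrite (negPf a0) oner_eq0 /= -map_poly_comp => h1.
  by rewrite -(eq_map_poly (f := in_alg K \o intr)) // => z; rewrite /= scaler_int.
have sq : size q1 = (adjoin_degree 1 x).+1.
  rewrite -size_minPoly Eq size_map_poly Eq1 size_scale // size_map_inj_poly //.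
  exact: intr_inj.
exists (lead_coef q1 *: q1); split.
- by rewrite monicE lead_coefZ l2.
- by rewrite size_scale // lead_coef_eq0 -size_poly_eq0 sq.
by rewrite -mul_polyC rmorphM /= rootM q1root orbT.
Qed.

Definition powers (x : K) : n.-tuple K := [tuple x ^+ i | i < n].

Lemma powersE x (i : 'I_n) : (powers x)`_i = x ^+ i.
Proof. by rewrite -tnth_nth tnth_mktuple. Qed.

Lemma powers_basis x : <<1; x>>%VS = fullv :> {vspace K} -> basis_of {:K} (powers x).
Proof.
move=> gx; rewrite basisEdim size_tuple leqnn andbT; apply/subvP => v _.
have nE : adjoin_degree 1 x = n by rewrite -gx dim_Fadjoin dimv1 muln1.
have vx : v \in <<1%AS; x>>%VS by rewrite gx memvf.
rewrite -(Fadjoin_poly_eq vx) horner_coef.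
apply: memv_suml => i _.
have /vlineP [k ->] := polyOverP (Fadjoin_polyOver 1%AS x v) i.
rewrite mulr_algl memvZ //.
have ni : (i < n)%N by rewrite -nE (leq_trans (ltn_ord i)) // size_Fadjoin_poly.
by rewrite -(powersE x (Ordinal ni)) memv_span // mem_nth // size_tuple.
Qed.

Lemma Zadjoin_reduce x y : integralOver (intr : int -> K) x ->
  <<1; x>>%VS = fullv :> {vspace K} -> Zadjoin x y ->
  exists2 g : {poly int}, (size g <= n)%N & (map_poly intr g).[x] = y.
Proof.
move=> ix gx [q _ <-]; have nE : adjoin_degree 1 x = n by rewrite -gx dim_Fadjoin dimv1 muln1.
have [h [hmon sh hx]] := monic_minimal_poly ix.
exists (Pdiv.CommonRing.rmodp q h).
  by rewrite -ltnS -nE -sh Pdiv.CommonRing.ltn_rmodp monic_neq0.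
rewrite [in RHS](Pdiv.RingMonic.rdivp_eq hmon q) rmorphD rmorphM /= hornerD hornerM.
by rewrite (rootP hx) mulr0 add0r.
Qed.

Lemma Zadjoin_span x : integralOver (intr : int -> K) x ->
  <<1; x>>%VS = fullv :> {vspace K} ->
  Zadjoin x = Zspan (fun i : 'I_n => (powers x)`_i).
Proof.
move=> ix gx; apply/seteqP; split=> [y /(Zadjoin_reduce ix gx) [r sr <-]|_ [z ->]].
  exists (fun i => r`_i); rewrite (horner_coef_wide _ (leq_trans (size_poly _ _) sr)).
  by apply: eq_bigr => i _; rewrite coef_map /= powersE mulrzl.
exists (\sum_(i < n) (z i)%:P * 'X^i) => //.
rewrite rmorph_sum horner_sum /=; apply: eq_bigr => i _.
by rewrite rmorphM /= map_polyC map_polyXn hornerM hornerXn hornerC powersE mulrzl.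
Qed.
End Powers.

(** * Indices from homomorphisms to the prime field *)

(** If S has a positive element n0, the common divisors are at most n0 and their lcm is the gcd;
    otherwise S contains at most 0, and 0 is the gcd. *)
Lemma gcd_setP (S : set nat) : is_gcd_set S (gcd_set S).
Proof.
rewrite /gcd_set; apply: xgetPex.
have [[n0 Sn0 n0_gt0]|S0] := pselect (exists2 n, S n & (0 < n)%N); last first.
  exists 0%N; split=> [n Sn|e _]; last exact: dvdn0.
  by case: n Sn => // n Sn; case: S0; exists n.+1.
pose common e := `[< forall n, S n -> (e %| n)%N >].
exists (\big[lcmn/1%N]_(e < n0.+1 | common e) e); split=> [n Sn|e he].
  by apply/dvdn_biglcmP => e /asboolP; apply.
have en0 : (e < n0.+1)%N by rewrite ltnS dvdn_leq ?he.
by apply: (biglcmn_sup (Ordinal en0)) => //; apply/asboolP.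
Qed.

Lemma vp_field_index (p : nat) (K : fieldExtType rat) (alpha : K) :
  (forall x : K, ring_of_integers x -> <<1; x>>%VS = fullv :> {vspace K} ->
     (p %| ind x)%N) ->
  ring_of_integers alpha -> <<1; alpha>>%VS = fullv :> {vspace K} ->
  prime p -> logn p (ind alpha) = 1%N ->
  vp p (field_index K)%:Z = 1%N.
Proof.
move=> hp ia ga pp l1; rewrite /vp absz_nat /field_index.
set S := (X in gcd_set X); have [dS Sd] := gcd_setP S.
(* An infinite index would be recorded as 0, whose valuation is 0 by convention. *)
have ind0 : (0 < ind alpha)%N by rewrite lt0n; apply/eqP => h; rewrite h logn0 in l1.
have d_ind : (gcd_set S %| ind alpha)%N by apply: dS; exists alpha.
have p_d : (p %| gcd_set S)%N by apply: Sd => _ [x [ix gx] <-]; apply: hp.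
apply/eqP; rewrite eqn_leq -{1}l1 dvdn_leq_log //=.
by rewrite -pfactor_dvdn ?expn1 ?(dvdn_gt0 ind0).
Qed.

Lemma integers0 (K : fieldExtType rat) : ring_of_integers (0 : K).
Proof. exact: integral0. Qed.

Lemma integersB (K : fieldExtType rat) (x y : K) :
  ring_of_integers x -> ring_of_integers y -> ring_of_integers (x - y).
Proof. exact: integral_sub. Qed.

Lemma Zadjoin_integers (K : fieldExtType rat) (x y : K) :
  ring_of_integers x -> Zadjoin x y -> ring_of_integers y.
Proof.
move=> ix [g _ <-]; elim/poly_ind: g => [|g c IH].
  by rewrite rmorph0 horner0; apply: integral0.
rewrite rmorphD rmorphM /= map_polyX map_polyC hornerMXaddC.
by apply: integral_add; [apply: integral_mul | apply: integral_id].
Qed.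

Lemma Zadjoin_denominator (K : fieldExtType rat) (a : K) :
  ring_of_integers a -> <<1; a>>%VS = fullv :> {vspace K} ->
  exists2 D, (1 < D)%N & forall x, ring_of_integers x ->
    Zspan (fun l : 'I_(\dim {:K}) => (powers a)`_l) (x *+ D).
Proof.
move=> ia gen.
have ipow (l : 'I_(\dim {:K})) : integralOver (intr : int -> K) (powers a)`_l.
  rewrite powersE; elim: (nat_of_ord l) => [|k IH]; first by rewrite expr0; apply: integral1.
  by rewrite exprS; apply: integral_mul.
have [D D0 hD] := denominator_bound (powers_basis gen) ipow.
(* Doubling ensures that the modulus exceeds 1, as the ring ['Z_1] is not trivial. *)
exists (`|D| * 2)%N; first lia.
move=> x ix; exists (fun l => numq (D%:~R * coord (powers a) l x) * (Num.sg D * 2)).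
  rewrite {1}(coord_basis (powers_basis gen) (memvf x)) -sumrMnl; apply: eq_bigr => l _.
  have numE : (numq (D%:~R * coord (powers a) l x))%:~R = D%:~R * coord (powers a) l x.
    exact: numqK (hD _ ix l).
  rewrite -[RHS](scaler_int (numq _ * _)) intrM numE -scaler_nat scalerA; congr (_ *: _).
  rewrite natrM -[(`|D|%N)%:R]/((`|D|%N)%:Z%:~R) abszE normrEsg !intrM; ring.
Qed.

(** * Orders maximal at p with more than p homomorphisms to the prime field *)

Section Core.
Context (K : fieldExtType rat) (p : nat) (pp : prime p).
Context (L : set K) (L1 : L 1).
Context (LB : forall x y, L x -> L y -> L (x - y)).
Context (LM : forall x y, L x -> L y -> L (x * y)).
Context (Lden : forall x, exists2 D, (0 < D)%N & L (x *+ D)).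
Context (Lmax : forall x, integralOver (intr : int -> K) x -> L (x *+ p) -> L x).
Context (I : finType) (phi : I -> K -> 'F_p).
Context (phi1 : forall i, phi i 1 = 1).
Context (phiB : forall i x y, L x -> L y -> phi i (x - y) = phi i x - phi i y).
Context (phiM : forall i x y, L x -> L y -> phi i (x * y) = phi i x * phi i y).

Lemma subring0 : L 0. Proof. by rewrite -(subrr 1); apply: LB. Qed.
Lemma subringN x : L x -> L (- x).
Proof. by move=> Lx; rewrite -sub0r; apply: LB => //; apply: subring0. Qed.
Lemma subringD x y : L x -> L y -> L (x + y).
Proof. by move=> Lx Ly; rewrite -[y]opprK; apply: LB => //; apply: subringN. Qed.
Lemma subringMn x k : L x -> L (x *+ k).
Proof. by move=> Lx; elim: k => [|k IH]; rewrite ?mulr0n ?mulrS; [apply: subring0 | apply: subringD]. Qed.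
Lemma subringMz x (k : int) : L x -> L (x *~ k).
Proof. by case: k => k Lx; [apply: subringMn | rewrite NegzE mulrNz; apply/subringN/subringMn]. Qed.
Lemma subring_intr (k : int) : L k%:~R. Proof. exact: subringMz. Qed.
Lemma subring_horner (g : {poly int}) x : L x -> L (map_poly intr g).[x].
Proof.
move=> Lx; elim/poly_ind: g => [|g c IH]; first by rewrite rmorph0 horner0; apply: subring0.
rewrite rmorphD rmorphM /= map_polyX map_polyC hornerMXaddC.
by apply: subringD; [apply: LM | apply: subring_intr].
Qed.

Lemma hom0 i : phi i 0 = 0.
Proof. by rewrite -(subrr 1) phiB // subrr. Qed.
Lemma homN i x : L x -> phi i (- x) = - phi i x.
Proof. by move=> Lx; rewrite -sub0r phiB ?hom0 ?sub0r //; apply: subring0. Qed.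
Lemma homD i x y : L x -> L y -> phi i (x + y) = phi i x + phi i y.
Proof. by move=> Lx Ly; rewrite -[y]opprK phiB ?homN ?opprK //; apply: subringN. Qed.
Lemma homMn i x k : L x -> phi i (x *+ k) = phi i x *+ k.
Proof.
move=> Lx; elim: k => [|k IH]; first by rewrite !mulr0n hom0.
by rewrite !mulrS homD ?IH //; apply: subringMn.
Qed.
Lemma homMz i x (k : int) : L x -> phi i (x *~ k) = phi i x *~ k.
Proof.
case: k => k Lx; first exact: homMn.
by rewrite NegzE !mulrNz homN ?homMn //; apply: subringMn.
Qed.
Lemma hom_horner i (g : {poly int}) x : L x ->
  phi i (map_poly intr g).[x] = (map_poly intr g).[phi i x].
Proof.
move=> Lx; elim/poly_ind: g => [|g c IH]; first by rewrite !rmorph0 !horner0 hom0.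
rewrite !rmorphD !rmorphM /= !map_polyX !map_polyC !hornerMXaddC /=.
rewrite homD ?phiM ?IH ?homMz ?phi1 //; try exact: subring_horner; last exact: subring_intr.
by apply: LM => //; apply: subring_horner.
Qed.

Lemma saturated_pow k x : integralOver (intr : int -> K) x -> L (x *+ p ^ k) -> L x.
Proof.
move=> ix; elim: k => [|k IH]; first by rewrite expn0 mulr1n.
rewrite expnSr mulrnA => h; apply: IH; apply: Lmax => //.
by rewrite -mulr_natr; apply: integral_mul => //; apply: integral_nat.
Qed.

(** Locally at p, L is the whole ring of integers: the p-part of a denominator of x is removed by
    saturation, and the part prime to p remains. *)
Lemma unit_multiple x : integralOver (intr : int -> K) x ->
  exists2 u, coprime u p & L (x *+ u).
Proof.
move=> ix; have [D D0 LD'] := Lden x.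
have [u hu Du] := pfactor_coprime pp D0.
exists u; first by rewrite coprime_sym.
apply: (@saturated_pow (logn p D)).
  by rewrite -mulr_natr; apply: integral_mul => //; apply: integral_nat.
by rewrite -mulrnA -Du.
Qed.

Lemma natFp_eq0 k : (k%:R == 0 :> 'F_p) = (p %| k)%N.
Proof. by rewrite -(dvdn_pcharf (pchar_Fp pp)). Qed.

Lemma natFp (x : 'F_p) : x *+ p = 0.
Proof. by rewrite -mulr_natr; apply/eqP; rewrite mulf_eq0 natFp_eq0 dvdnn orbT. Qed.

Context (cardI : (p < #|I|)%N).
Context (separate : forall i j, i != j -> exists2 z, L z & phi i z != phi j z).

(* More than p homomorphisms to F_p cannot take distinct values at alpha, and two that agree at
   alpha agree on Z[alpha]. *)
Lemma Zadjoin_defect x : integralOver (intr : int -> K) x ->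
  exists2 z, L z & forall d, Zadjoin x (z *+ d) -> (p %| d)%N.
Proof.
move=> ix; have [u cu Lu] := unit_multiple ix.
have [inj|] := boolP (injectiveb (fun i => phi i (x *+ u))).
  have := leq_card _ (injectiveP _ inj); rewrite card_Fp // leqNgt.
  by rewrite cardI.
case/injectivePn => i [j ij eij].
have [z Lz zij] := separate ij.
exists z => // d [g _ hg].
(* Only u x is known to lie in L, so g is homogenized: G(u x) = u^N g(x), where N is the size of
   g. *)
pose G : {poly int} := \poly_(k < size g) (g`_k * u%:Z ^+ (size g - k)).
have GE : (map_poly intr G).[x *+ u] = z *+ (d * u ^ size g).
  rewrite mulrnA -hg (@horner_coef_wide _ (size g) (map_poly intr g)) ?size_poly //.
  rewrite (@horner_coef_wide _ (size g)); last first.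
    by rewrite (leq_trans (size_poly _ _)) // size_poly.
  rewrite -sumrMnl; apply: eq_bigr => k _.
  rewrite !coef_map /= coef_poly ltn_ord rmorphM /= exprMn_n -mulr_natr.
  rewrite -[RHS]mulr_natr !natrX rmorphXn /= -[u%:Z%:~R]/(u%:R).
  by rewrite -[X in _ = _ * u%:R ^+ X](@subnK k) ?(ltnW (ltn_ord _)) // exprD; ring.
have : phi i (z *+ (d * u ^ size g)) = phi j (z *+ (d * u ^ size g)).
  by rewrite -GE !hom_horner // eij.
rewrite !homMn // => /eqP; rewrite -subr_eq0 -mulrnBl -mulr_natr mulf_eq0 subr_eq0.
rewrite (negPf zij) /= natFp_eq0 Euclid_dvdM // => /orP[//|].
by rewrite Euclid_dvdX // => /andP[pu _]; move: cu; rewrite coprime_sym prime_coprime // pu.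
Qed.

Context (Lint : forall x, L x -> integralOver (intr : int -> K) x).

(** The index multiplies every integral element into Z[x], in particular the z of [Zadjoin_defect],
    for which only multiples of p achieve this. *)
Lemma dvdn_ind x : ring_of_integers x -> <<1; x>>%VS = fullv :> {vspace K} -> (p %| ind x)%N.
Proof.
move=> ix gx; have [z Lz] := Zadjoin_defect ix; rewrite (Zadjoin_span ix gx) => hz.
have [D2 D2_gt1 DO] := Zadjoin_denominator ix gx.
have BO y : Zspan (fun l : 'I_(\dim {:K}) => (powers x)`_l) y -> ring_of_integers y.
  by rewrite -(Zadjoin_span ix gx); apply: Zadjoin_integers.
rewrite /ind (Zadjoin_span ix gx); apply: hz.
exact: (add_index_kills (powers_basis gx) (integers0 K) (@integersB K) BO D2_gt1 DO (Lint Lz)).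
Qed.

Lemma not_monogenic : ~ monogenic K.
Proof.
case=> x ix eq_x; have [z Lz hz] := Zadjoin_defect ix.
have : (p %| 1)%N by apply: hz; rewrite mulr1n -eq_x; apply: Lint.
by rewrite dvdn1 => /eqP p1; have := pp; rewrite p1.
Qed.

(** * An element whose index has p-adic valuation one *)

Section Generator.
Context (dimK : \dim {:K} = 6%N).
Context (a0 e : K) (La0 : L a0) (Le : L e) (T : {poly int}) (i j : I).
Context (T5 : T`_5 = 1) (aij : phi i a0 = phi j a0) (eij : phi i e != phi j e).
Context (dT : (map_poly intr T^`()).[phi i a0] != 0).
Context (kerT : forall g : {poly int}, (size g <= 6)%N ->
  (exists2 x, L x & (map_poly intr g).[a0] = x *+ p) ->
  exists k g', g = k *: T + p%:Z *: g').

Lemma taylor2 (g : {poly int}) x y : L x -> L y -> exists2 q, L q &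
  (map_poly intr g).[x + y] =
    (map_poly intr g).[x] + (map_poly intr g^`()).[x] * y + q * y ^+ 2.
Proof.
move=> Lx Ly; elim/poly_ind: g => [|g c [q Lq IH]].
  by exists 0; rewrite ?deriv0 ?rmorph0 ?horner0 ?mul0r ?addr0 //; apply: subring0.
exists ((map_poly intr g^`()).[x] + q * (x + y)).
  by apply: subringD; [apply: subring_horner | apply: LM => //; apply: subringD].
rewrite derivD derivM derivX derivC addr0 mulr1.
rewrite !rmorphD !rmorphM /= !map_polyX !map_polyC !hornerMXaddC /= IH.
by rewrite !hornerE /=; ring.
Qed.

Lemma pmul_inj (x y : K) : x *+ p = y *+ p -> x = y.
Proof.
move=> h; have : (p%:R : rat) *: x = (p%:R : rat) *: y by rewrite !scaler_nat.
by apply: scalerI; rewrite pnatr_eq0 -lt0n prime_gt0.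
Qed.

(* T(a0) = p x0 forces T(a0 + p e) = p x1 with x1 = x0 + e T'(a0) mod p L, so x0 and x1 cannot
   both have the same image under phi i and phi j. *)
Lemma exists_generator : exists2 a, exists2 x, L x & a = a0 + x *+ p &
  forall x, L x -> (map_poly intr T).[a] = x *+ p -> phi i x != phi j x.
Proof.
have [[x0 [Lx0 hx0 ex0]]|h] := pselect (exists x0,
    [/\ L x0, (map_poly intr T).[a0] = x0 *+ p & phi i x0 = phi j x0]); last first.
  exists a0; first by exists 0; rewrite ?mul0rn ?addr0 //; apply: subring0.
  by move=> x Lx hx; apply/eqP => ex; case: h; exists x.
exists (a0 + e *+ p); first by exists e.
move=> x Lx; have [q Lq ->] := taylor2 T La0 (subringMn p Le).
set d := (map_poly intr T^`()).[a0].
have Ld : L d by apply: subring_horner.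
have -> : (map_poly intr T).[a0] + d * (e *+ p) + q * (e *+ p) ^+ 2 =
    (x0 + d * e + (q * e ^+ 2) *+ p) *+ p.
  by rewrite hx0; ring.
move/pmul_inj <-.
have Lde : L (d * e) by apply: LM.
have Lq2 : L (q * e ^+ 2) by rewrite expr2; do ! apply: LM.
have phiE l : phi l (x0 + d * e + (q * e ^+ 2) *+ p) = phi l x0 + phi l d * phi l e.
  by rewrite !homD ?homMn ?natFp ?addr0 ?phiM //; [apply: subringD | apply: subringMn].
rewrite !phiE ex0 (inj_eq (addrI _)) /d !hom_horner // -aij.
by rewrite (inj_eq (mulfI dT)).
Qed.

(** The p-primary torsion of O_K modulo Z[a] comes from L, and there [phi i - phi j] detects
    membership in Z[a]; hence this torsion has at most p elements. That p divides the index is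
    [dvdn_ind]. *)
Lemma index_valuation : exists2 a, ring_of_integers a &
  <<1; a>>%VS = fullv :> {vspace K} /\ logn p (ind a) = 1%N.
Proof.
have [a [xa Lxa ea] Ta] := exists_generator.
have La : L a by rewrite ea; apply: subringD => //; apply: subringMn.
have ia : ring_of_integers a by apply: Lint.
(* Passing from [a0] to [a] changes g(a0) by an element of p L only, so the description of relations
   modulo p carries over. *)
have ga0 (g : {poly int}) : exists2 y, L y &
    (map_poly intr g).[a0] = (map_poly intr g).[a] + y *+ p.
  have a0E : a0 = a + (- xa) *+ p by rewrite ea mulNrn addrK.
  have [q Lq] := taylor2 g La (subringMn p (subringN Lxa)).
  rewrite -a0E => ->.
  exists ((map_poly intr g^`()).[a] * - xa + q * ((- xa) * ((- xa) *+ p))).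
    apply: subringD; repeat (apply: LM || apply: subringMn || apply: subringN || apply: subring_horner) => //.
  by ring.
have kerTa (g : {poly int}) x : (size g <= 6)%N -> L x ->
    (map_poly intr g).[a] = x *+ p -> exists k g', g = k *: T + p%:Z *: g'.
  move=> sg Lx gx; apply: kerT => //; have [y Ly ->] := ga0 g.
  by exists (x + y); [apply: subringD | rewrite gx mulrnDl].
have p_nu (k : int) : k * p%:Z <> 1.
  move=> h; have := intUnitRing.unitzPl h; rewrite qualifE /= eqz_nat orbF => /eqP hp.
  by have := pp; rewrite hp.
(* A proper divisor of 6 is less than 5, so a minimal polynomial of such a degree has no term in
   X^5. Being a multiple of T modulo p, it would vanish modulo p although it is monic. *)
have gen : <<1; a>>%VS = fullv :> {vspace K}.
  have [f [fmon sf froot]] := monic_minimal_poly ia.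
  have dd : (\dim <<1; a>>%VS %| 6)%N by rewrite -dimK; apply: field_dimS; apply: subvf.
  rewrite dim_Fadjoin dimv1 muln1 in dd.
  have [d6|dn6] := eqVneq (adjoin_degree 1 a) 6%N.
    by apply/eqP; rewrite eqEdim subvf dimK dim_Fadjoin dimv1 muln1 d6.
  have d5 : (adjoin_degree 1 a < 5)%N.
    move: dd dn6 (dvdn_leq (isT : (0 < 6)%N) dd).
    by case: (adjoin_degree 1 a) => [|[|[|[|[|[|[|]]]]]]].
  have sf6 : (size f <= 6)%N by rewrite sf; lia.
  have fa0 : (map_poly intr f).[a] = 0 *+ p by rewrite (rootP froot) mul0rn.
  have [c [g' hE]] := kerTa f 0 sf6 subring0 fa0.
  have c5 : c = p%:Z * - g'`_5.
    have : f`_5 = 0 by rewrite nth_default // sf.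
    by rewrite hE coefD !coefZ T5 mulr1 => /eqP; rewrite addr_eq0 => /eqP ->; ring.
  have : f`_(adjoin_degree 1 a) = 1.
    by rewrite -(monicP fmon) lead_coefE sf.
  rewrite hE c5 coefD !coefZ -mulrA -mulrDr mulrC => /p_nu [].
exists a => //; split=> //.
have Lg (g : {poly int}) : L (map_poly intr g).[a] by apply: subring_horner.
have phia l : phi l a = phi l a0.
  by rewrite ea homD ?homMn //; [rewrite natFp addr0 | apply: subringMn].
have phig (g : {poly int}) : phi i (map_poly intr g).[a] = phi j (map_poly intr g).[a].
  by rewrite !hom_horner // !phia aij.
(* From p x = g(a) with g = k T + p g' follows k T(a) = p (x - g'(a)). If p divides k, then x lies
   in Z[a]. Otherwise T(a) is p times an element of L taking the same value at i and j, which the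
   choice of [a] excludes. *)
have sat x : L x -> phi i x = phi j x -> Zadjoin a (x *+ p) -> Zadjoin a x.
  move=> Lx ex /(Zadjoin_reduce ia gen); rewrite dimK => -[g sg gx].
  have [k [g' gE]] := kerTa g x sg Lx gx.
  have kT : (map_poly intr T).[a] *~ k = (x - (map_poly intr g').[a]) *+ p.
    rewrite mulrnBl -gx gE rmorphD -!mul_polyC !rmorphM /= !map_polyC hornerD !hornerCM /=.
    by rewrite -(mulr_natl _ p) addrK mulrzl.
  have [/dvdzP [k' hk]|ndvd] := boolP (p%:Z %| k)%Z.
    exists (g' + k' *: T) => //.
    apply: pmul_inj; rewrite rmorphD -mul_polyC rmorphM /= map_polyC hornerD hornerCM /=.
    have kp : (map_poly intr T).[a] *~ k' *+ p = (map_poly intr T).[a] *~ k.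
      by rewrite pmulrn -mulrzA -hk.
    by rewrite mulrnDl mulrzl kp kT mulrnBl addrC subrK.
  have : coprimez k p by rewrite coprimezE absz_nat coprime_sym prime_coprime.
  case/coprimezP => -[l m] /= lm.
  (* With l k + m p = 1, this is T(a) / p written as a combination of elements on which phi i and
     phi j agree. *)
  pose y := (x - (map_poly intr g').[a]) *~ l + (map_poly intr T).[a] *~ m.
  have Lx' : L (x - (map_poly intr g').[a]) by apply: LB.
  have Ly : L y by apply: subringD; apply: subringMz.
  have Ty : (map_poly intr T).[a] = y *+ p.
    rewrite /y mulrnDl !pmulrn mulrzAC -pmulrn -kT -!mulrzA -mulrzDr.
    by rewrite [k * l]mulrC lm mulr1z.
  have := Ta y Ly Ty.
  by rewrite /y !homD ?homMz ?phiB ?phig ?ex ?eqxx //; apply: subringMz.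
have sat_pow k x : L x -> phi i x = phi j x -> Zadjoin a (x *+ p ^ k) -> Zadjoin a x.
  elim: k x => [|k IH] x Lx ex; first by rewrite expn0 mulr1n.
  rewrite expnS mulrnA => h; apply: sat => //; apply: (IH (x *+ p)) => //.
    exact: subringMn.
  by rewrite !homMn // ex.
have [D2 D2_gt1 DO] := Zadjoin_denominator ia gen.
have O0 := integers0 K; have OB := @integersB K.
have BO x : Zspan (fun l : 'I_(\dim {:K}) => (powers a)`_l) x -> ring_of_integers x.
  by rewrite -(Zadjoin_span ia gen); apply: Zadjoin_integers.
have indE : ind a = add_index (@ring_of_integers K)
    (Zspan (fun l : 'I_(\dim {:K}) => (powers a)`_l)).
  by rewrite /ind (Zadjoin_span ia gen).
apply/eqP; rewrite eqn_leq indE; apply/andP; split.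
  apply: (logn_add_index_le1 (powers_basis gen) O0 OB BO D2_gt1 DO
            (delta := fun x => phi i x - phi j x) pp) => k x y ix iy.
  rewrite -(Zadjoin_span ia gen) => hx hy exy.
  have BL z : Zadjoin a z -> L z by case=> g _ <-.
  have Lx : L x by apply: (saturated_pow ix (BL _ hx)).
  have Ly : L y by apply: (saturated_pow iy (BL _ hy)).
  apply: (sat_pow k); first exact: LB.
    have {}exy : phi i x - phi j x = phi i y - phi j y := exy.
    rewrite !phiB //; have -> : phi i x = phi i y - phi j y + phi j x by rewrite -exy subrK.
    by ring.
  rewrite mulrnBl; case: hx hy => [g _ <-] [g' _ <-].
  by exists (g - g') => //; rewrite rmorphB hornerD hornerN.
have gt0 := add_index_gt0 (powers_basis gen) O0 OB BO D2_gt1 DO.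
by rewrite -(pfactor_dvdn 1 pp gt0) expn1 -indE; apply: dvdn_ind.
Qed.

Lemma vp_index_core : vp p (field_index K)%:Z = 1%N.
Proof.
have [a ia [ga la]] := index_valuation.
exact: (vp_field_index dvdn_ind ia ga pp la).
Qed.
End Generator.

End Core.

(** * Orders given by a multiplication table *)

Section Order.
Context (K : fieldExtType rat) (n : nat) (w : 'I_n -> K) (i1 : 'I_n) (w1 : w i1 = 1).
Context (p : nat) (pp : prime p) (I : finType) (r : I -> 'I_n -> 'F_p).
Context (r1 : forall l, r l i1 = 1).
Context (table : forall i j, exists2 z : 'I_n -> int, w i * w j = \sum_k w k *~ z k &
  forall l, \sum_k (z k)%:~R * r l k = r l i * r l j).
Local Notation L := (Zspan w).

Lemma order_one : L 1. Proof. by rewrite -w1; apply: Zspan_gen. Qed.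

Lemma order_mul x y : L x -> L y -> L (x * y).
Proof.
move=> [z ->] [z' ->]; rewrite mulr_suml; apply: Zspan_sum => i _.
rewrite mulr_sumr; apply: Zspan_sum => j _.
have [u hu _] := table i j.
by rewrite mulrzAl mulrzAr; do 2! apply: Zspan_mulz; exists u.
Qed.

Lemma order_horner (x : K) (g : {poly rat}) : L x ->
  (map_poly (in_alg K) g).[x] \in <<[seq w i | i : 'I_n]>>%VS.
Proof.
move=> Lx; have sub y : L y -> y \in <<[seq w i | i : 'I_n]>>%VS.
  move=> [z ->]; apply: memv_suml => i _.
  by rewrite -scaler_int memvZ // memv_span // map_f // mem_enum.
have pw k : L (x ^+ k).
  by elim: k => [|k IH]; rewrite ?expr0 ?exprS; [apply: order_one | apply: order_mul].
rewrite horner_coef; apply: memv_suml => i _.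
by rewrite coef_map mulr_algl memvZ // sub.
Qed.

Context (th : K) (Lth : L th) (gth : <<1; th>>%VS = fullv :> {vspace K}).
Context (dimK : \dim {:K} = n).
Local Notation wt := [tuple w i | i < n].

(** L is a ring containing [th], so its rational span contains Q(th) = K; as many generators as the
    dimension then form a basis. *)
Lemma order_basis : basis_of {:K} wt.
Proof.
rewrite basisEdim size_tuple dimK leqnn andbT; apply/subvP => v _.
have /Fadjoin_polyP [q /polyOver1P [g ->] ->] : v \in <<1%AS; th>>%VS by rewrite gth memvf.
by have := order_horner g Lth; rewrite /= -/(codom _) codomE.
Qed.

Lemma order_coord z i : coord wt i (\sum_j w j *~ z j) = (z i)%:~R.
Proof.
rewrite -(coord_sum_free (fun j => (z j)%:~R) i (basis_free order_basis)).
by congr (coord _ _ _); apply: eq_bigr => j _; rewrite -scaler_int -tnth_nth tnth_mktuple.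
Qed.

(** Numerators make this total on K; it is the intended reduction on L, where the coordinates are
    integers. *)
Definition order_hom l x : 'F_p := \sum_k (numq (coord wt k x))%:~R * r l k.
Local Notation phi := order_hom.

Lemma order_homE l z : phi l (\sum_j w j *~ z j) = \sum_k (z k)%:~R * r l k.
Proof. by apply: eq_bigr => k _; rewrite order_coord numq_int. Qed.

Lemma order_hom_gen l i : phi l (w i) = r l i.
Proof.
have -> : w i = \sum_j w j *~ (j == i)%:R.
  by rewrite (bigD1 i) //= eqxx mulr1z big1 ?addr0 // => j /negPf ->; rewrite mulr0z.
rewrite order_homE (bigD1 i) //= eqxx mul1r big1 ?addr0 // => j /negPf ->.
by rewrite mul0r.
Qed.

Lemma order_hom1 l : phi l 1 = 1.
Proof. by rewrite -w1 order_hom_gen r1. Qed.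

Lemma order_homB l x y : L x -> L y -> phi l (x - y) = phi l x - phi l y.
Proof.
move=> [z ->] [z' ->]; rewrite !order_homE -!sumrB.
rewrite (eq_bigr (fun j => w j *~ (z j - z' j))) => [|j _]; last by rewrite mulrzBr.
by rewrite order_homE; apply: eq_bigr => k _; rewrite intrB mulrBl.
Qed.

Lemma order_homM l x y : L x -> L y -> phi l (x * y) = phi l x * phi l y.
Proof.
have homD u v : L u -> L v -> phi l (u + v) = phi l u + phi l v.
  exact: (homD (@order_one) (@ZspanB _ _ w) order_homB).
have phiZ u k : L u -> phi l (u *~ k) = phi l u *~ k.
  exact: (homMz order_one (@ZspanB _ _ w) order_homB).
have phiS (m : nat) (F : 'I_m -> K) : (forall i, L (F i)) ->
    phi l (\sum_i F i) = \sum_i phi l (F i).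
  elim: m F => [|m IH] F LF.
    by rewrite !big_ord0 -(subrr 1) order_homB ?subrr //; apply: order_one.
  rewrite !big_ord_recl homD ?IH //.
  by apply: Zspan_sum.
move=> [z ->] [z' ->].
have Lww i j : L (w i * w j) by have [u hu _] := table i j; exists u.
have Lz i : L (w i *~ z i) by apply/Zspan_mulz/Zspan_gen.
have Lz' i : L (w i *~ z' i) by apply/Zspan_mulz/Zspan_gen.
rewrite mulr_suml !phiS //; last first.
  by move=> i; rewrite mulr_sumr; apply: Zspan_sum => j _; apply: order_mul.
rewrite mulr_suml; apply: eq_bigr => i _; rewrite !mulr_sumr phiS => [|j]; last exact: order_mul.
apply: eq_bigr => j _.
rewrite mulrzAl mulrzAr !phiZ ?order_hom_gen //; try exact: Zspan_gen; last exact: Zspan_mulz.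
have [u -> hu] := table i j.
by rewrite order_homE hu mulrzAl mulrzAr.
Qed.

Lemma order_denominator x : exists2 D, (0 < D)%N & L (x *+ D).
Proof.
pose c i := coord wt i x.
pose D := (\prod_i `|denq (c i)|)%N.
exists D; first by apply: prodn_gt0 => i; rewrite absz_gt0 denq_neq0.
have : x *+ D = \sum_i w i *~ (numq (c i) * (\prod_(j | j != i) `|denq (c j)|)%N).
  rewrite {1}(coord_basis order_basis (memvf x)) -sumrMnl; apply: eq_bigr => i _.
  rewrite -tnth_nth tnth_mktuple -scaler_int -scaler_nat scalerA; congr (_ *: _).
  rewrite /D (bigD1 i) //= natrM -/(c i) intrM numqE.
  rewrite -[(`|_|%N)%:R]/((`|denq (c i)|%N)%:Z%:~R) absz_denq -[in LHS]/((_%:Z)%:~R).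
  by ring.
by move=> ->; exists (fun i => numq (c i) * (\prod_(j | j != i) `|denq (c j)|)%N).
Qed.

(** The row of the generators is an eigenvector, with eigenvalue x, of the integer matrix of
    multiplication by x; it is nonzero since 1 occurs in it. *)
Lemma order_integral x : L x -> integralOver (intr : int -> K) x.
Proof.
move=> Lx.
have /choice [z hz] : forall i, exists z : 'I_n -> int, x * w i = \sum_k w k *~ z k.
  by move=> i; have [z hz] := order_mul Lx (Zspan_gen w i); exists z.
pose M : 'M[int]_n := \matrix_(i, k) z k i.
exists (char_poly M); first exact: char_poly_monic.
have -> : map_poly intr (char_poly M) = char_poly (map_mx intr M) :> {poly K}.
  by rewrite map_char_poly.
rewrite -eigenvalue_root_char; apply/eigenvalueP; exists (\row_k w k).
  apply/rowP=> k; rewrite !mxE hz; apply: eq_bigr => i _.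
  by rewrite !mxE mulrzr.
by apply/negP => /eqP /rowP /(_ i1); rewrite !mxE w1 => /eqP; rewrite oner_eq0.
Qed.

Lemma order_pdiv z : (forall i, (p %| z i)%Z) <-> exists2 x, L x & \sum_i w i *~ z i = x *+ p.
Proof.
split=> [dv|[_ [u ->] h] i].
  exists (\sum_i w i *~ (z i %/ p)%Z); first by exists (fun i => (z i %/ p)%Z).
  rewrite -sumrMnl; apply: eq_bigr => i _.
  by rewrite pmulrn -mulrzA divzK.
have := order_coord z i; rewrite h linearMn /= order_coord.
by rewrite -mulr_natr -[p%:R]/(p%:Z%:~R) -intrM => /intr_inj <-; apply: dvdz_mull.
Qed.

(* The integral equation of x, multiplied by p ^ d, expresses (p x) ^ d as a combination of lower
   powers of p x with coefficients divisible by p. *)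
Lemma order_nilpotent x : integralOver (intr : int -> K) x -> L (x *+ p) ->
  exists d, exists2 q, L q & (x *+ p) ^+ d = q *+ p.
Proof.
move=> [h hmon hx] Lpx; set y := x *+ p in Lpx *.
have [N sN] : exists N, size h = N.+1.
  by exists (size h).-1; rewrite prednK // lt0n size_poly_eq0 monic_neq0.
exists N; exists (- \sum_(i < N) (y ^+ i *+ p ^ (N - i).-1) *~ h`_i).
  apply/ZspanN/Zspan_sum => i _; apply: Zspan_mulz.
  rewrite pmulrn; apply: Zspan_mulz; elim: (nat_of_ord i) => [|k IH].
    by rewrite expr0; apply: order_one.
  by rewrite exprS; apply: order_mul.
have hN : h`_N = 1 by rewrite -(monicP hmon) lead_coefE sN.
have : (map_poly intr h).[x] *+ p ^ N = 0 by rewrite (rootP hx) mul0rn.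
rewrite (@horner_coef_wide _ N.+1) -?sN ?size_poly // sN big_ord_recr /=.
rewrite coef_map /= hN mul1r mulrnDl -sumrMnl => /eqP; rewrite addrC addr_eq0 => /eqP e.
rewrite /y exprMn_n e mulNrn -sumrMnl; congr (- _); apply: eq_bigr => i _.
rewrite coef_map /= mulrzl exprMn_n !pmulrn -!mulrzA; congr (_ *~ _).
have -> : (p ^ N = p ^ i * p ^ (N - i).-1 * p)%N.
  by rewrite -mulnA -expnSr -expnD prednK ?subn_gt0 // subnKC // ltnW.
by rewrite !PoszM; ring.
Qed.

(** p x is nilpotent modulo p L, and a field has no nonzero nilpotent. *)
Lemma order_hom_integral l x : integralOver (intr : int -> K) x -> L (x *+ p) -> phi l (x *+ p) = 0.
Proof.
move=> ix Lx; have [d [q Lq h]] := order_nilpotent ix Lx.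
have phiX k : phi l ((x *+ p) ^+ k) = phi l (x *+ p) ^+ k.
  elim: k => [|k IH]; first by rewrite !expr0 order_hom1.
  rewrite !exprS order_homM ?IH //; elim: k {IH} => [|k IH].
    by rewrite expr0; apply: order_one.
  by rewrite exprS; apply: order_mul.
apply/eqP; have := phiX d; rewrite h.
have -> : phi l (q *+ p) = 0.
  rewrite (homMn order_one (@ZspanB _ _ w) order_homB) // -mulr_natr.
  by apply/eqP; rewrite mulf_eq0 (natFp_eq0 pp) dvdnn orbT.
by move/esym/eqP; rewrite expf_eq0 => /andP[].
Qed.

Let LB := @ZspanB K n w.
Let phiB := order_homB.
Let phiM := order_homM.

Lemma order_hom_pmul l x : L x -> phi l (x *+ p) = 0.
Proof. by move=> Lx; rewrite (homMn order_one LB phiB) // natFp. Qed.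

(** An element both nilpotent and idempotent modulo p L is zero there. This handles a prime of
    degree greater than one, which no homomorphism to F_p detects. *)
Lemma order_idempotent x : integralOver (intr : int -> K) x -> L (x *+ p) ->
  (exists2 q, L q & (x *+ p) ^+ 2 = x *+ p + q *+ p) -> L x.
Proof.
move=> ix Lx [q Lq idem]; set y := x *+ p in Lx idem.
have [d [q' Lq' yd]] := order_nilpotent ix Lx.
have LX k : L (y ^+ k).
  by elim: k => [|k IH]; rewrite ?expr0 ?exprS; [apply: order_one | apply: order_mul].
have pw k : exists2 u, L u & y ^+ k.+1 = y + u *+ p.
  elim: k => [|k [u Lu IH]]; first by exists 0; rewrite ?expr1 ?mul0rn ?addr0 //; apply: Zspan0.
  exists (q + y * u); first by apply: ZspanD => //; apply: order_mul.
  by rewrite exprS IH mulrDr -expr2 idem mulrnAr mulrnDl addrA.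
have [u Lu hu] := pw d.
have -> : x = y * q' - u; last by apply: ZspanB => //; apply: order_mul.
apply: (pmul_inj pp); rewrite mulrnBl -mulrnAr -yd -exprS hu addrK //.
Qed.

(** * Relations modulo p satisfied by an element of the order *)

Section Kernel.
Context (a0 : K) (La0 : L a0).

Lemma simple_root l (g : {poly int}) x : L x -> (map_poly intr g).[a0] = x *+ p ->
  (map_poly intr g).[phi l a0] = 0.
Proof.
move=> Lx gx.
by rewrite -(hom_horner order_one LB order_mul order_hom1 phiB phiM) // gx order_hom_pmul.
Qed.

(* pi is divisible by the prime above p belonging to l, and (a0 - s) * pi is p times a unit at
   that prime, so the valuation of a0 - s is too small for s to be a simple root. *)
Lemma double_root l (s : int) (g : {poly int}) pi mu x : L x -> L pi -> L mu ->
  (map_poly intr g).[a0] = x *+ p -> phi l a0 = s%:~R ->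
  phi l pi = 0 -> (a0 - s%:~R) * pi = mu *+ p -> phi l mu != 0 ->
  (map_poly intr g^`()).[s%:~R : 'F_p] = 0.
Proof.
move=> Lx Lpi Lmu gx as_ pi0 pimu mu0.
have Ls : L s%:~R by apply: (subring_intr order_one LB).
have Le : L (a0 - s%:~R) by apply: ZspanB.
have [q Lq] := taylor2 order_one LB order_mul g Ls Le; rewrite subrKC gx => tay.
have hs : (map_poly intr g).[s%:~R : K] = (g.[s])%:~R by rewrite horner_map.
have hs' : (map_poly intr g^`()).[s%:~R : K] = (g^`().[s])%:~R by rewrite horner_map.
have /dvdzP [m gm] : (p%:Z %| g.[s])%Z.
  rewrite (dvdz_pcharf (pchar_Fp pp)); apply/eqP.
  have -> : (g.[s])%:~R = (map_poly intr g).[s%:~R : 'F_p] by rewrite horner_map.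
  by rewrite -as_ (simple_root l Lx gx).
(* The Taylor expansion at s, multiplied by pi and divided by p: under phi l everything vanishes
   except the term in g'(s). *)
have xE : x * pi = m%:~R * pi + (g^`().[s])%:~R * mu + q * ((a0 - s%:~R) * mu).
  apply: (pmul_inj pp); rewrite -mulrnAl tay hs hs' gm intrM -[p%:Z%:~R]/(p%:R).
  rewrite [LHS](_ : _ = m%:~R * p%:R * pi + (g^`().[s])%:~R * ((a0 - s%:~R) * pi) +
    q * (a0 - s%:~R) * ((a0 - s%:~R) * pi)); last by ring.
  by rewrite pimu; ring.
have ph0 : phi l (a0 - s%:~R) = 0.
  rewrite phiB // as_.
  by rewrite (homMz order_one LB phiB) ?order_hom1 ?subrr //; apply: order_one.
have Lz (z : int) : L z%:~R by apply: (subring_intr order_one LB).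
have phiz (z : int) : phi l z%:~R = z%:~R.
  by rewrite (homMz order_one LB phiB) ?order_hom1 //; apply: order_one.
have L1 : L (m%:~R * pi) by apply: order_mul.
have L2 : L ((g^`().[s])%:~R * mu) by apply: order_mul.
have L3 : L ((a0 - s%:~R) * mu) by apply: order_mul.
have L4 : L (q * ((a0 - s%:~R) * mu)) by apply: order_mul.
have L5 : L (m%:~R * pi + (g^`().[s])%:~R * mu) by apply: ZspanD.
have : phi l (x * pi) = (g^`().[s])%:~R * phi l mu.
  rewrite xE (homD order_one LB phiB) // (homD order_one LB phiB) // !phiM //.
  by rewrite ph0 pi0 !phiz !(mulr0, mul0r, add0r, addr0).
rewrite phiM // pi0 mulr0 => /esym/eqP; rewrite mulf_eq0 (negPf mu0) orbF => /eqP.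
by rewrite horner_map.
Qed.

(** Write g = X^2 h + g_1 X + g_0. Multiplying g(a0) by pi and dividing by p turns the first term
    into h(a0) nu and leaves multiples of pi from the other two; as phi l kills pi and a0, only g_2
    phi l nu survives. *)
Lemma triple_root0 l (g : {poly int}) pi nu x : L x -> L pi -> L nu ->
  (map_poly intr g).[a0] = x *+ p -> phi l a0 = 0 -> (p%:Z %| g`_0)%Z -> (p%:Z %| g`_1)%Z ->
  phi l pi = 0 -> a0 ^+ 2 * pi = nu *+ p -> phi l nu != 0 -> ((g`_2)%:~R : 'F_p) = 0.
Proof.
move=> Lx Lpi Lnu gx a00 /dvdzP [m0 g0] /dvdzP [m1 g1] pi0 pinu nu0.
have [h gE] : exists h, g = h * 'X^2 + (g`_1)%:P * 'X + (g`_0)%:P.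
  exists (drop_poly 2 g); rewrite -{1}(poly_take_drop 2 g) addrC -addrA; congr (_ + _).
  apply/polyP => k; rewrite coef_take_poly !coefD coefMX !coefC.
  by case: k => [|[|k]]; rewrite /= ?addr0 ?add0r.
have h0 : h`_0 = g`_2 by rewrite [in RHS]gE !coefD coefMXn coefMX !coefC /= !addr0.
have Lh : L (map_poly intr h).[a0] by apply: (subring_horner order_one LB order_mul).
have xE : x * pi = (map_poly intr h).[a0] * nu + (a0 * m1%:~R + m0%:~R) * pi.
  apply: (pmul_inj pp); rewrite -mulrnAl -gx {1}gE g0 g1.
  rewrite !rmorphD !rmorphM /= !map_polyX !map_polyC /= !hornerE /=.
  rewrite mulrnDl -mulrnAr -pinu.
  by rewrite -[p%:~R]/(p%:R); ring.
have Lm (k : int) : L k%:~R by apply: (subring_intr order_one LB).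
have Lc : L (a0 * m1%:~R + m0%:~R) by apply: ZspanD => //; apply: order_mul.
have : phi l (x * pi) = (g`_2)%:~R * phi l nu.
  rewrite xE (homD order_one LB phiB); try exact: order_mul.
  rewrite !phiM // pi0 mulr0 addr0 (hom_horner order_one LB order_mul order_hom1 phiB phiM) // a00.
  by rewrite horner_coef0 coef_map /= h0.
rewrite phiM // pi0 mulr0 => /esym/eqP.
by rewrite mulf_eq0 (negPf nu0) orbF => /eqP.
Qed.

End Kernel.

Lemma poly_mod_scale (g T : {poly int}) (k : int) (m : nat) :
  (size g <= m)%N -> (size T <= m)%N ->
  (forall i, (i < m)%N -> ((g`_i)%:~R : 'F_p) = (k * T`_i)%:~R) ->
  exists k g', g = k *: T + p%:Z *: g'.
Proof.
move=> sg sT h; exists k, (\poly_(i < m) ((g`_i - k * T`_i) %/ p)%Z).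
apply/polyP => i; rewrite coefD !coefZ coef_poly.
have [im|mi] := ltnP i m; last by rewrite !nth_default ?mulr0 ?addr0 // ?(leq_trans sg) ?(leq_trans sT).
rewrite [p%:Z * _]mulrC divzK ?subrKC //.
by rewrite (dvdz_pcharf (pchar_Fp pp)) intrB h // subrr.
Qed.

Context (n6 : n = 6%N) (cardI : (p < #|I|)%N).
Context (Lmax : forall x, integralOver (intr : int -> K) x -> L (x *+ p) -> L x).
Context (separate : forall i j, i != j -> exists2 z, L z & phi i z != phi j z).

Lemma order_conclusion (a0 e : K) (T : {poly int}) i j : L a0 -> L e -> T`_5 = 1 ->
  phi i a0 = phi j a0 -> phi i e != phi j e -> (map_poly intr T^`()).[phi i a0] != 0 ->
  (forall g : {poly int}, (size g <= 6)%N ->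
    (exists2 x, L x & (map_poly intr g).[a0] = x *+ p) ->
    exists k g', g = k *: T + p%:Z *: g') ->
  vp p (field_index K)%:Z = 1%N /\ ~ monogenic K.
Proof.
move=> La0 Le T5 aij eij dT kerT; split.
  apply: (vp_index_core pp order_one LB order_mul order_denominator Lmax order_hom1 phiB phiM
            cardI separate order_integral _ La0 Le T5 aij eij dT kerT).
  by rewrite dimK.
exact: (not_monogenic pp order_one LB order_mul order_denominator Lmax order_hom1 phiB phiM
            cardI separate order_integral).
Qed.
End Order.

(** * Sextic orders at 3 *)

Definition gens (K : zmodType) (W : seq K) (i : 'I_6) : K := W`_i.

(** Coefficient lists may have fewer than six entries, the missing ones being read as 0. *)
Definition comb6 (K : zmodType) (W : seq K) (z : seq int) : K :=
  W`_0 *~ z`_0 + W`_1 *~ z`_1 + W`_2 *~ z`_2 + W`_3 *~ z`_3 + W`_4 *~ z`_4 + W`_5 *~ z`_5.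

Lemma sum6 (V : zmodType) (F : 'I_6 -> V) (G : nat -> V) : (forall i, F i = G i) ->
  \sum_i F i = G 0%N + G 1%N + G 2%N + G 3%N + G 4%N + G 5%N.
Proof. by move=> h; rewrite (eq_bigr _ (fun i _ => h i)) !big_ord_recr big_ord0 /= add0r. Qed.

Lemma comb6E (K : zmodType) (W : seq K) (z : seq int) :
  \sum_i gens W i *~ z`_i = comb6 W z.
Proof. by rewrite (@sum6 _ _ (fun i => W`_i *~ z`_i)). Qed.

(* The l-th row of R lists the values of the l-th homomorphism on the generators W. *)
Definition vals (R : seq (seq 'F_3)) (l : 'I_4) (i : 'I_6) : 'F_3 := (nth [::] R l)`_i.

Definition val6 (r : seq 'F_3) (z : seq int) : 'F_3 :=
  (z`_0)%:~R * r`_0 + (z`_1)%:~R * r`_1 + (z`_2)%:~R * r`_2 + (z`_3)%:~R * r`_3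
  + (z`_4)%:~R * r`_4 + (z`_5)%:~R * r`_5.

Lemma val6E R (z : seq int) l : \sum_(k < 6) (z`_k)%:~R * vals R l k = val6 (nth [::] R l) z.
Proof. by rewrite (@sum6 _ _ (fun k => (z`_k)%:~R * (nth [::] R l)`_k)). Qed.

Lemma forall_ltn6 (P : nat -> Prop) : P 0%N -> P 1%N -> P 2%N -> P 3%N -> P 4%N -> P 5%N ->
  forall i, (i < 6)%N -> P i.
Proof. by move=> ? ? ? ? ? ? [|[|[|[|[|[|i]]]]]]. Qed.

Lemma forall_ltn4 (P : nat -> Prop) : P 0%N -> P 1%N -> P 2%N -> P 3%N -> forall i, (i < 4)%N -> P i.
Proof. by move=> ? ? ? ? [|[|[|[|i]]]]. Qed.

Lemma gens_table (K : comPzRingType) (W : seq K) (R : seq (seq 'F_3)) :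
  (forall i j, (i <= j)%N -> (j < 6)%N -> exists2 c : seq int, W`_i * W`_j = comb6 W c &
     forall l, (l < 4)%N -> val6 (nth [::] R l) c = (nth [::] R l)`_i * (nth [::] R l)`_j) ->
  forall i j : 'I_6, exists2 z : 'I_6 -> int, gens W i * gens W j = \sum_k gens W k *~ z k &
    forall l : 'I_4, \sum_k (z k)%:~R * vals R l k = vals R l i * vals R l j.
Proof.
move=> h i j; wlog ij : i j / (i <= j)%N.
  move=> H; have [/H //|/ltnW /H [z e1 e2]] := leqP i j.
  by exists z => [|l]; rewrite 1?mulrC ?e1 ?e2 // mulrC.
have [c e1 e2] := h i j ij (ltn_ord j).
exists (fun k => c`_k) => [|l]; first by rewrite comb6E.
by rewrite val6E e2.
Qed.

Lemma intF3_eq0 (k : int) : ((k%:~R : 'F_3) == 0) = (3%:Z %| k)%Z.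
Proof. by rewrite (dvdz_pcharf (pchar_Fp (isT : prime 3))). Qed.

Lemma intr_neq0 (K : fieldExtType rat) (k : int) : k != 0 -> (k%:~R : K) != 0.
Proof.
move=> k0; have -> : (k%:~R : K) = (k%:~R : rat)%:A by rewrite scaler_int.
by rewrite scaler_eq0 oner_eq0 orbF intr_eq0.
Qed.

Section Order6.
Context (K : fieldExtType rat) (W : seq K) (R : seq (seq 'F_3)).
Context (W0 : gens W ord0 = 1) (R0 : forall l, vals R l ord0 = 1).
Context (table : forall i j, (i <= j)%N -> (j < 6)%N ->
  exists2 c : seq int, W`_i * W`_j = comb6 W c &
  forall l, (l < 4)%N -> val6 (nth [::] R l) c = (nth [::] R l)`_i * (nth [::] R l)`_j).
Context (gth : <<1; W`_1>>%VS = fullv :> {vspace K}) (dimK : \dim {:K} = 6%N).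
Local Notation L := (Zspan (gens W)).
Local Notation integral := (integralOver (intr : int -> K)).

Definition phi6 : 'I_4 -> K -> 'F_3 := order_hom (gens W) (vals R).
Local Notation phi := phi6.

Let T6 := gens_table table.
Let Lth : L W`_1. Proof. exact: (Zspan_gen (gens W) (lift ord0 ord0)). Qed.

Lemma comb6_order c : L (comb6 W c). Proof. by rewrite -comb6E; exists (fun i => c`_i). Qed.

Lemma order_comb6 x : L x ->
  exists z0 z1 z2 z3 z4 z5 : int, x = comb6 W [:: z0; z1; z2; z3; z4; z5].
Proof.
move=> [z ->]; exists (z (inord 0)), (z (inord 1)), (z (inord 2)), (z (inord 3)), (z (inord 4)), (z (inord 5)).
rewrite (@sum6 _ _ (fun i => W`_i *~ z (inord i))) // => i.
by rewrite /gens inord_val.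
Qed.

Lemma phi6_comb l c : phi l (comb6 W c) = val6 (nth [::] R l) c.
Proof. by rewrite -comb6E /phi (order_homE W0 T6 Lth gth dimK) val6E. Qed.

Lemma comb6_pmul c x : L x -> comb6 W c = x *+ 3 -> forall i, (i < 6)%N -> (c`_i)%:~R = 0 :> 'F_3.
Proof.
move=> Lx cx i i6; apply/eqP; rewrite intF3_eq0.
have := (order_pdiv W0 T6 Lth gth dimK (fun k : 'I_6 => c`_k)).2.
by rewrite comb6E cx => /(_ (ex_intro2 _ _ x Lx erefl)) /(_ (Ordinal i6)).
Qed.

Lemma order6M x y : L x -> L y -> L (x * y). Proof. exact: (order_mul T6). Qed.

Lemma phi6B l x y : L x -> L y -> phi l (x - y) = phi l x - phi l y.
Proof. exact: (order_homB W0 T6 Lth gth dimK). Qed.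

Lemma phi6M l x y : L x -> L y -> phi l (x * y) = phi l x * phi l y.
Proof. exact: (order_homM W0 T6 Lth gth dimK). Qed.

Lemma phi6D l x y : L x -> L y -> phi l (x + y) = phi l x + phi l y.
Proof. exact: (homD (order_one W0) (@ZspanB _ _ _) phi6B). Qed.

Lemma phi6Mz l x k : L x -> phi l (x *~ k) = phi l x *~ k.
Proof. exact: (homMz (order_one W0) (@ZspanB _ _ _) phi6B). Qed.

Lemma phi6_integral l x : integral x -> L (x *+ 3) -> phi l (x *+ 3) = 0.
Proof. exact: (order_hom_integral W0 (isT : prime 3) R0 T6 Lth gth dimK). Qed.

Lemma order6_integral x : L x -> integral x. Proof. exact: (order_integral W0 T6). Qed.

Definition order6_idempotent := order_idempotent W0 (isT : prime 3) T6.
Lemma simple_root6 a0 l (g : {poly int}) x : L a0 -> L x ->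
  (map_poly intr g).[a0] = x *+ 3 -> (map_poly intr g).[phi l a0] = 0.
Proof. by move=> La; apply: (simple_root W0 (isT : prime 3) R0 T6 Lth gth dimK La). Qed.

Lemma double_root6 a0 l (s : int) (g : {poly int}) pi mu x : L a0 -> L x -> L pi -> L mu ->
  (map_poly intr g).[a0] = x *+ 3 -> phi l a0 = s%:~R -> phi l pi = 0 ->
  (a0 - s%:~R) * pi = mu *+ 3 -> phi l mu != 0 -> (map_poly intr g^`()).[s%:~R : 'F_3] = 0.
Proof. by move=> La; apply: (double_root W0 (isT : prime 3) R0 T6 Lth gth dimK La). Qed.

Lemma triple_root6 a0 l (g : {poly int}) pi nu x : L a0 -> L x -> L pi -> L nu ->
  (map_poly intr g).[a0] = x *+ 3 -> phi l a0 = 0 ->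
  (g`_0)%:~R = 0 :> 'F_3 -> (g`_1)%:~R = 0 :> 'F_3 ->
  phi l pi = 0 -> a0 ^+ 2 * pi = nu *+ 3 -> phi l nu != 0 -> (g`_2)%:~R = 0 :> 'F_3.
Proof.
move=> La Lx Lpi Lnu gx a00 /eqP + /eqP; rewrite !intF3_eq0 => g0 g1.
exact: (triple_root0 W0 (isT : prime 3) R0 T6 Lth gth dimK La Lx Lpi Lnu gx a00 g0 g1).
Qed.

Definition conclusion6 := order_conclusion W0 (isT : prime 3) R0 T6 Lth gth dimK erefl.

Lemma phi6_gen l i : phi l (gens W i) = vals R l i.
Proof. exact: (order_hom_gen W0 T6 Lth gth dimK). Qed.

(* Valuations at the prime above 3 belonging to l: 1/3 for pi and 2/3 for pi2. *)
Lemma order6_maximal_cubic l (pi pi2 tau sigma sigma' x : K) : L pi -> L pi2 -> L tau ->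
  L sigma -> L sigma' -> phi l pi = 0 -> phi l pi2 = 0 ->
  phi l sigma != 0 -> phi l sigma' != 0 ->
  pi * pi2 = tau *+ 3 -> pi ^+ 3 = sigma *+ 3 -> pi2 ^+ 3 = sigma' *+ 9 ->
  integral x -> (exists z z' q, L q /\ x *+ 3 = pi *~ z + pi2 *~ z' + q *+ 3) -> L x.
Proof.
move=> Lpi Lpi2 Lt Ls Ls' pi0 pi20 s0 s'0 pipi2 pi3 pi23 ix [z [z' [q [Lq xq]]]].
have LI := order6_integral.
have IZ y (k : int) : integral y -> integral (y *~ k).
  by move=> iy; rewrite -mulrzr; apply: integral_mul => //; apply: integral_id.
have iy : integral (x - q) by apply: integral_sub => //; apply: LI.
have y3 : (x - q) *+ 3 = pi *~ z + pi2 *~ z' by rewrite mulrnBl xq addrK.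
(* X equals 3 (x - q)^2 pi, three times an integral element, so phi l kills it. Only the term sigma
   z^2 survives under phi l, which forces 3 to divide z. *)
pose X := sigma *~ z ^+ 2 + (pi * tau) *~ (2 * z * z') + (pi2 * tau) *~ z' ^+ 2.
have L1 k : L (sigma *~ k) by apply: Zspan_mulz.
have Lpt : L (pi * tau) by apply: order6M.
have Lpt2 : L (pi2 * tau) by apply: order6M.
have L2 k : L ((pi * tau) *~ k) by apply: Zspan_mulz.
have L3 k : L ((pi2 * tau) *~ k) by apply: Zspan_mulz.
have L4 k k' : L (sigma *~ k + (pi * tau) *~ k') by apply: ZspanD.
have LX : L X by apply: ZspanD.
have XE : ((x - q) ^+ 2 * pi) *+ 3 = X.
  apply: (pmul_inj (isT : prime 3)).
  transitivity (((x - q) *+ 3) ^+ 2 * pi); first by ring.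
  rewrite y3; transitivity (pi ^+ 3 *~ z ^+ 2 + (pi * (pi * pi2)) *~ (2 * z * z')
    + (pi2 * (pi * pi2)) *~ z' ^+ 2); first by ring.
  by rewrite pi3 pipi2 /X; ring.
have phX : phi l X = 0.
  rewrite -XE; apply: phi6_integral; last by rewrite XE.
  by apply: integral_mul; [rewrite expr2; apply: integral_mul | apply: LI].
have /eqP : phi l X = phi l sigma *~ z ^+ 2.
  by rewrite /X !phi6D // !phi6Mz // !phi6M // pi0 pi20 !mul0r !mul0rz !addr0.
rewrite phX eq_sym -mulrzr mulf_eq0 (negPf s0) /= intF3_eq0 expr2 => h.
have {h} /dvdzP [m hm] : (3%:Z %| z)%Z.
  by move: h; rewrite -!intF3_eq0 intrM mulf_eq0 orbb.
have y3' : (x - q - pi *~ m) *+ 3 = pi2 *~ z' by rewrite mulrnBl y3 hm; ring.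
have iy' : integral (x - q - pi *~ m) by apply: integral_sub => //; apply/LI/Zspan_mulz.
(* Once the part in pi is removed, the cube of the remainder pi2 z' / 3 is integral, and three times
   it is sigma' z'^3; hence 3 divides z'. *)
have YE : ((x - q - pi *~ m) ^+ 3) *+ 3 = sigma' *~ z' ^+ 3.
  apply: (pmul_inj (isT : prime 3)); apply: (pmul_inj (isT : prime 3)).
  transitivity (((x - q - pi *~ m) *+ 3) ^+ 3); first by ring.
  rewrite y3'; transitivity (pi2 ^+ 3 *~ z' ^+ 3); first by ring.
  by rewrite pi23; ring.
have : phi l (sigma' *~ z' ^+ 3) = 0.
  rewrite -YE; apply: phi6_integral; last by rewrite YE; apply: Zspan_mulz.
  by rewrite !exprS expr0 mulr1; do ! apply: integral_mul.
rewrite phi6Mz // -mulrzr => /eqP; rewrite mulf_eq0 (negPf s'0) /= rmorphXn expf_eq0 /=.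
rewrite intF3_eq0 => /dvdzP [m' hm'].
have -> : x = q + pi *~ m + pi2 *~ m'.
  apply: (pmul_inj (isT : prime 3)); rewrite -[x](subrK q) -[x - q](subrK (pi *~ m)).
  by rewrite 2!mulrnDl y3' hm'; ring.
by apply: ZspanD; [apply: ZspanD => //|]; apply: Zspan_mulz.
Qed.

(* Two primes of ramification index 2, with uniformizers pi and pi'. *)
Lemma order6_maximal_quadratic l l' (pi pi' tau tau' sigma x : K) : L pi -> L pi' ->
  L tau -> L tau' -> L sigma -> pi ^+ 2 = tau *+ 3 -> pi' ^+ 2 = tau' *+ 3 ->
  pi * pi' = sigma *+ 3 -> phi l tau != 0 -> phi l tau' = 0 -> phi l sigma = 0 ->
  phi l' tau' != 0 -> phi l' tau = 0 -> phi l' sigma = 0 ->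
  integral x -> (exists z z' q, L q /\ x *+ 3 = pi *~ z + pi' *~ z' + q *+ 3) -> L x.
Proof.
move=> Lpi Lpi' Lt Lt' Ls pi2 pi'2 pipi' lt lt' ls l't' l't l's ix [z [z' [q [Lq xq]]]].
have LI := order6_integral.
have y3 : (x - q) *+ 3 = pi *~ z + pi' *~ z' by rewrite mulrnBl xq addrK.
have iy : integral (x - q) by apply: integral_sub => //; apply: LI.
(* X equals 3 (x - q)^2 and is killed by every homomorphism; l sees only tau z^2 and l' only tau'
   z'^2. *)
pose X := tau *~ z ^+ 2 + sigma *~ (2 * z * z') + tau' *~ z' ^+ 2.
have L1 k : L (tau *~ k) by apply: Zspan_mulz.
have L2 k : L (tau' *~ k) by apply: Zspan_mulz.
have L3 k : L (sigma *~ k) by apply: Zspan_mulz.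
have L4 k k' : L (tau *~ k + sigma *~ k') by apply: ZspanD.
have XE : ((x - q) ^+ 2) *+ 3 = X.
  apply: (pmul_inj (isT : prime 3)).
  transitivity (((x - q) *+ 3) ^+ 2); first by ring.
  rewrite y3; transitivity (pi ^+ 2 *~ z ^+ 2 + (pi * pi') *~ (2 * z * z')
    + pi' ^+ 2 *~ z' ^+ 2); first by ring.
  by rewrite pi2 pi'2 pipi' /X; ring.
have phX k : phi k X = 0.
  rewrite -XE; apply: phi6_integral; first by rewrite expr2; apply: integral_mul.
  by rewrite XE; exact: (ZspanD (L4 _ _) (L2 _)).
have sq0 (k : int) : ((k ^+ 2)%:~R : 'F_3) == 0 -> exists m, k = m * 3.
  by rewrite rmorphXn expf_eq0 /= intF3_eq0 => /dvdzP.
have [m hm] : exists m, z = m * 3.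
  apply: sq0; have /eqP := phX l; rewrite /X !phi6D // !phi6Mz // lt' ls !mul0rz !addr0.
  by rewrite -mulrzr mulf_eq0 (negPf lt).
have [m' hm'] : exists m, z' = m * 3.
  apply: sq0; have /eqP := phX l'; rewrite /X !phi6D // !phi6Mz // l't l's !mul0rz !add0r.
  by rewrite -mulrzr mulf_eq0 (negPf l't').
have -> : x = q + pi *~ m + pi' *~ m'.
  apply: (pmul_inj (isT : prime 3)); rewrite -[x](subrK q).
  by rewrite mulrnDl y3 hm hm'; ring.
by apply: ZspanD; [apply: ZspanD => //|]; apply: Zspan_mulz.
Qed.
End Order6.

Lemma F3_three : ((3 : int)%:~R : 'F_3) = 0. Proof. by apply/eqP. Qed.

(* The numeral 3 is generalised before its image is set to 0, as intrD would expand it. *)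
Ltac f3 := let t := fresh "t" in let t0 := fresh "t0" in
  rewrite /val6 /=; have := F3_three; move: (3 : int) => t t0;
  repeat first [rewrite intrM | rewrite intrD | rewrite mulrNz];
  rewrite /= ?t0; ring.

Ltac tab c :=
  exists c; [rewrite /comb6 /= ?expr1n; try ring | by apply: forall_ltn4; f3].

Lemma F3_sum_squares (x y : 'F_3) : x ^+ 2 + y ^+ 2 = 0 -> x = 0 /\ y = 0.
Proof.
by case: x => -[|[|[|//]]] ?; case: y => -[|[|[|//]]] ? => /eqP; rewrite -val_eqE //= => _;
  split; apply/eqP; rewrite -val_eqE.
Qed.

Lemma F3_two : (2 : 'F_3) != 0. Proof. by []. Qed.

Lemma horner6 (R : comNzRingType) (g : {poly int}) (x : R) : (size g <= 6)%N ->
  (map_poly intr g).[x] = (g`_0)%:~R + (g`_1)%:~R * x + (g`_2)%:~R * x ^+ 2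
    + (g`_3)%:~R * x ^+ 3 + (g`_4)%:~R * x ^+ 4 + (g`_5)%:~R * x ^+ 5.
Proof.
move=> sg; rewrite (@horner_coef_wide _ 6) ?(leq_trans (size_poly _ _)) //.
rewrite (@sum6 _ _ (fun i => (map_poly intr g)`_i * x ^+ i)) //.
by rewrite !coef_map /= expr0 expr1 mulr1.
Qed.

Lemma F3_sqr (x : 'F_3) : x != 0 -> x * x = 1.
Proof. by case: x => -[|[|[|//]]] ? // _; apply/eqP; rewrite -val_eqE. Qed.

Lemma cancel_mulz (K : fieldExtType rat) (k : int) (x y : K) : k != 0 -> x *~ k = y *~ k -> x = y.
Proof. by move=> k0 h; apply: (mulfI (intr_neq0 K k0)); rewrite !mulrzl. Qed.

(** * The case m = 2: four primes of degree one and one of degree two, all unramified *)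

Section CaseTwo.
Context (K : fieldExtType rat) (th eta : K) (P b' c2 a' : int).
Context (gth : <<1; th>>%VS = fullv :> {vspace K}) (dimK : \dim {:K} = 6%N).
Context (P0 : P != 0) (b'3 : (b'%:~R : 'F_3) != 0).
Context (E1 : th ^+ 5 = eta *~ (3 * P) - th *~ (9 * a' - 1) - (3 * P * b')%:~R).
Context (E2 : th * eta = - (9 * P * c2)%:~R).

(** Multiplication by 3 P turns one factor into a polynomial in [th], whose product with [eta] is
    known from [E2]; the scalar is then cancelled. The products of the other cases are found in the
    same way. *)
Lemma two_ee : eta ^+ 2 = eta *~ b' - (th ^+ 4 + (9 * a' - 1)%:~R) *~ (3 * c2).
Proof.
apply: (mulfI (@intr_neq0 _ (3 * P) _)); first by lia.
have -> : (3 * P)%:~R * eta ^+ 2 = eta * (th ^+ 5 + th *~ (9 * a' - 1) + (3 * P * b')%:~R).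
  by rewrite E1; ring.
have -> : eta * (th ^+ 5 + th *~ (9 * a' - 1) + (3 * P * b')%:~R) =
  (th * eta) * (th ^+ 4 + (9 * a' - 1)%:~R) + (3 * P * b')%:~R * eta by ring.
by rewrite E2; ring.
Qed.

Lemma two_th6 : th ^+ 6 = - (27 * P ^+ 2 * c2)%:~R - th ^+ 2 *~ (9 * a' - 1) - th *~ (3 * P * b').
Proof.
rewrite exprS E1; have -> : th * (eta *~ (3 * P) - th *~ (9 * a' - 1) - (3 * P * b')%:~R) =
    (th * eta) *~ (3 * P) - th ^+ 2 *~ (9 * a' - 1) - th *~ (3 * P * b') by ring.
  by rewrite E2; ring.
Qed.

Local Notation W := [:: 1; th; th ^+ 2; th ^+ 3; th ^+ 4; eta].
Local Notation B := (b'%:~R : 'F_3).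
(** At the first prime [th] has larger valuation than 3 P, so [eta] reduces to b'; at the second,
    where the valuations are equal, [eta] = - 9 P c2 / [th] reduces to 0. The prime of degree two,
    where [th] is a square root of -1, has no row. *)
Local Notation R := [:: [:: 1; 0; 0; 0; 0; B]; [:: 1; 0; 0; 0; 0; 0];
                        [:: 1; 1; 1; 1; 1; 0]; [:: 1; -1; 1; -1; 1; 0]].

Lemma two_table i j : (i <= j)%N -> (j < 6)%N -> exists2 c : seq int, W`_i * W`_j = comb6 W c &
     forall l, (l < 4)%N -> val6 (nth [::] R l) c = (nth [::] R l)`_i * (nth [::] R l)`_j.
Proof.
case: i => [|[|[|[|[|[|i]]]]]]; case: j => [|[|[|[|[|[|j]]]]]] //= _ _.
- tab [:: 1 : int].
- tab [:: 0; 1 : int].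
- tab [:: 0; 0; 1 : int].
- tab [:: 0; 0; 0; 1 : int].
- tab [:: 0; 0; 0; 0; 1 : int].
- tab [:: 0; 0; 0; 0; 0; 1 : int].
- tab [:: 0; 0; 1 : int].
- tab [:: 0; 0; 0; 1 : int].
- tab [:: 0; 0; 0; 0; 1 : int].
(* Coefficients are displayed as a residue plus an explicit multiple of 3, the form in which [f3]
   reduces them. *)
- tab [:: - (3 * P * b'); 1 + 3 * (- (3 * a')); 0; 0; 0; 3 * P].
  by rewrite -exprS E1; ring.
- tab [:: - (3 * (3 * P * c2))].
  by rewrite E2; ring.
- tab [:: 0; 0; 0; 0; 1 : int].
- tab [:: - (3 * P * b'); 1 + 3 * (- (3 * a')); 0; 0; 0; 3 * P].
  by rewrite -exprD E1; ring.
- tab [:: - (3 * (9 * P * P * c2)); - (3 * P * b'); 1 + 3 * (- (3 * a'))].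
  by rewrite (_ : _ * _ = th ^+ 6); [rewrite two_th6 | ]; ring.
- tab [:: 0; - (3 * (3 * P * c2))].
  by rewrite expr2 -mulrA E2; ring.
- tab [:: - (3 * (9 * P * P * c2)); - (3 * P * b'); 1 + 3 * (- (3 * a'))].
  by rewrite (_ : _ * _ = th ^+ 6); [rewrite two_th6 | ]; ring.
- tab [:: 0; - (3 * (9 * P * P * c2)); - (3 * P * b'); 1 + 3 * (- (3 * a'))].
  by rewrite (_ : _ * _ = th * th ^+ 6); [rewrite two_th6 | ]; ring.
- tab [:: 0; 0; - (3 * (3 * P * c2))].
  by rewrite exprSr -mulrA E2; ring.
- tab [:: 0; 0; - (3 * (9 * P * P * c2)); - (3 * P * b'); 1 + 3 * (- (3 * a'))].
  by rewrite (_ : _ * _ = th ^+ 2 * th ^+ 6); [rewrite two_th6 | ]; ring.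
- tab [:: 0; 0; 0; - (3 * (3 * P * c2))].
  by rewrite exprSr -mulrA E2; ring.
- tab [:: - (3 * (c2 * (9 * a' - 1))); 0; 0; 0; - (3 * c2); b'].
  by rewrite -expr2 two_ee; ring.
Qed.

Lemma conclusion_two : vp 3 (field_index K)%:Z = 1%N /\ ~ monogenic K.
Proof.
have W0 : gens W ord0 = 1 by [].
have R0 l : vals R l ord0 = 1 by case: l => -[|[|[|[|]]]].
have comb_phi := phi6_comb W0 two_table gth dimK.
pose l0 : 'I_4 := Ordinal (isT : (0 < 4)%N); pose l1 : 'I_4 := Ordinal (isT : (1 < 4)%N).
pose l2 : 'I_4 := Ordinal (isT : (2 < 4)%N); pose l3 : 'I_4 := Ordinal (isT : (3 < 4)%N).
have combL := comb6_order W; have int_comb c := order6_integral W0 two_table (combL c).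
have thE : th = comb6 W [:: 0; 1] by rewrite /comb6 /=; ring.
have etaE : eta = comb6 W [:: 0; 0; 0; 0; 0; 1] by rewrite /comb6 /=; ring.
have Lmax x : integralOver (intr : int -> K) x -> Zspan (gens W) (x *+ 3) -> Zspan (gens W) x.
  move=> ix Lx; have [z0 [z1 [z2 [z3 [z4 [z5 xE]]]]]] := order_comb6 Lx.
  have v l : phi6 W R l (x *+ 3) = 0 := phi6_integral W0 R0 two_table gth dimK l ix Lx.
  pose Z (z : int) : 'F_3 := z%:~R.
  have h0 : Z z0 = 0 by rewrite -[RHS](v l1) xE comb_phi /val6 /Z /=; ring.
  have v0 : Z z0 + Z z5 * B = 0 by rewrite -[RHS](v l0) xE comb_phi /val6 /Z /=; ring.
  have v2 : Z z0 + Z z1 + Z z2 + Z z3 + Z z4 = 0.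
    by rewrite -[RHS](v l2) xE comb_phi /val6 /Z /=; ring.
  have v3 : Z z0 - Z z1 + Z z2 - Z z3 + Z z4 = 0.
    by rewrite -[RHS](v l3) xE comb_phi /val6 /Z /=; ring.
  have h5 : Z z5 = 0 by apply: (mulIf b'3); rewrite mul0r -[RHS]v0 h0 add0r.
  have h3 : Z (z3 + z1) = 0.
    apply: (mulfI F3_two); rewrite mulr0.
    by transitivity ((Z z0 + Z z1 + Z z2 + Z z3 + Z z4) - (Z z0 - Z z1 + Z z2 - Z z3 + Z z4));
      [rewrite /Z; ring | rewrite v2 v3 subr0].
  have h4 : Z (z4 + z2) = 0.
    apply: (mulfI F3_two); rewrite mulr0.
    by transitivity ((Z z0 + Z z1 + Z z2 + Z z3 + Z z4) + (Z z0 - Z z1 + Z z2 - Z z3 + Z z4));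
      [rewrite h0 /Z; ring | rewrite v2 v3 addr0].
  have {h0 h3 h4 h5} [[m0 h0] [m3 h3] [m4 h4] [m5 h5]] : [/\ exists m, z0 = m * 3,
     exists m, z3 = m * 3 - z1, exists m, z4 = m * 3 - z2 & exists m, z5 = m * 3].
    split.
    - by move/eqP: h0; rewrite intF3_eq0 => /dvdzP.
    - move/eqP: h3; rewrite intF3_eq0 => /dvdzP [m hm]; exists m; rewrite -hm; ring.
    - move/eqP: h4; rewrite intF3_eq0 => /dvdzP [m hm]; exists m; rewrite -hm; ring.
    - by move/eqP: h5; rewrite intF3_eq0 => /dvdzP.
  (* These two elements span, modulo 3, the common kernel of the four homomorphisms: the part of the
     order carried by the prime of degree two. *)
  pose u := th - th ^+ 3; pose v' := th ^+ 2 - th ^+ 4.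
  have Lu : Zspan (gens W) u.
    rewrite (_ : u = comb6 W [:: 0; 1; 0; -1]) //; first exact: combL.
    by rewrite /comb6 /u /=; ring.
  have Lv : Zspan (gens W) v'.
    rewrite (_ : v' = comb6 W [:: 0; 0; 1; 0; -1]) //; first exact: combL.
    by rewrite /comb6 /v' /=; ring.
  pose q := comb6 W [:: m0; 0; 0; m3; m4; m5].
  pose U := comb6 W [:: - (9 * P * P * c2); - (P * b'); 1 - 3 * a'; 0; -1].
  pose V := comb6 W [:: 18 * P * P * c2; 2 * P * b'; 6 * a' - 1 - 9 * P * P * c2; - (P * b'); 1 - 3 * a'].
  have xqE : (x - q) *+ 3 = u *~ z1 + v' *~ z2.
    by rewrite mulrnBl xE h0 h3 h4 h5 /q /comb6 /u /v' /=; ring.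
  have iq : integralOver (intr : int -> K) q := int_comb _.
  have Lq : Zspan (gens W) q := combL _.
  have LU : Zspan (gens W) U := combL _.
  have LV : Zspan (gens W) V := combL _.
  have ixq : integralOver (intr : int -> K) (x - q) by apply: integral_sub.
  have u2 : u ^+ 2 = - v' + U *+ 3.
    have -> : u ^+ 2 = th ^+ 2 - th ^+ 4 *+ 2 + th ^+ 6 by rewrite /u; ring.
    by rewrite two_th6 /U /v' /comb6 /=; ring.
  have v2' : v' ^+ 2 = v' + V *+ 3.
    have -> : v' ^+ 2 = th ^+ 4 - th ^+ 6 *+ 2 + th ^+ 2 * th ^+ 6 by rewrite /v'; ring.
    by rewrite two_th6 /V /v' /comb6 /=; ring.
  (* u and v' span the quadratic residue field F_3(i), where v' = 1, u ^+ 2 = -1 and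
     z1 ^+ 2 + z2 ^+ 2 is the norm of v' *~ z2 + u *~ z1. *)
  have [k3|k3] := boolP (3%:Z %| z1 ^+ 2 + z2 ^+ 2)%Z.
    have [] := @F3_sum_squares (Z z1) (Z z2).
      by apply/eqP; rewrite -!rmorphXn -rmorphD /= intF3_eq0.
    move=> /eqP; rewrite intF3_eq0 => /dvdzP [m1 hm1] /eqP; rewrite intF3_eq0 => /dvdzP [m2 hm2].
    have -> : x = q + (u *~ m1 + v' *~ m2).
      apply: (pmul_inj (isT : prime 3)); rewrite mulrnDl -[x *+ 3](subrK (q *+ 3)) -mulrnBl xqE.
      by rewrite hm1 hm2; ring.
    by apply: ZspanD => //; apply: ZspanD; apply: Zspan_mulz.
  have : coprimez (z1 ^+ 2 + z2 ^+ 2) 3 by rewrite coprimezE coprime_sym prime_coprime.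
  case/coprimezP => -[l m] /= lm.
  (* Multiplying x - q by the conjugate gives the norm times v' / 3 up to L. As the norm is prime to
     3, a Bezout combination yields y = v' / 3, which is thus integral. *)
  pose y := ((x - q) * (v' *~ z2 - u *~ z1) - (V *~ z2 ^+ 2 - U *~ z1 ^+ 2)) *~ l + v' *~ m.
  have y3 : y *+ 3 = v'.
    transitivity (((x - q) *+ 3 * (v' *~ z2 - u *~ z1) - (V *~ z2 ^+ 2 - U *~ z1 ^+ 2) *+ 3) *~ l
       + v' *~ (m * 3)); first by rewrite /y; ring.
    rewrite xqE; transitivity ((v' ^+ 2 *~ z2 ^+ 2 - u ^+ 2 *~ z1 ^+ 2
       - (V *~ z2 ^+ 2 - U *~ z1 ^+ 2) *+ 3) *~ l + v' *~ (m * 3)); first by ring.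
    rewrite u2 v2'; transitivity (v' *~ (l * (z1 ^+ 2 + z2 ^+ 2) + m * 3)); first by ring.
    by rewrite lm mulr1z.
  have iy : integralOver (intr : int -> K) y.
    have LI := order6_integral W0 two_table.
    apply: integral_add; last by apply: LI; apply: Zspan_mulz.
    rewrite -mulrzr; apply: integral_mul; last exact: integral_id.
    apply: integral_sub; last by apply: LI; apply: ZspanB; apply: Zspan_mulz.
    by apply: integral_mul => //; apply: LI; apply: ZspanB; apply: Zspan_mulz.
  have Ly : Zspan (gens W) y.
    apply: (order6_idempotent W0 two_table iy); rewrite y3 //.
    by exists V.
  (* v' is idempotent modulo 3, so y would lie in L, although v' has a coefficient 1. *)
  have v'E : comb6 W [:: 0; 0; 1; 0; -1] = y *+ 3 by rewrite y3 /comb6 /v' /=; ring.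
  by have := comb6_pmul W0 two_table gth dimK Ly v'E (isT : (2 < 6)%N).
have c4 : (3 < #|'I_4|)%N by rewrite card_ord.
have phi_th l : phi6 W R l th = vals R l (lift ord0 ord0).
  by have := comb_phi l [:: 0; 1]; rewrite -thE => ->; rewrite /val6 /vals /=; ring.
have phi_eta l : phi6 W R l eta = vals R l ord_max.
  by have := comb_phi l [:: 0; 0; 0; 0; 0; 1]; rewrite -etaE => ->; rewrite /val6 /vals /=; ring.
have Lth : Zspan (gens W) th by have := combL [:: 0; 1]; rewrite -thE.
have Leta : Zspan (gens W) eta by have := combL [:: 0; 0; 0; 0; 0; 1]; rewrite -etaE.
have separate i j : i != j -> exists2 z, Zspan (gens W) z & phi6 W R i z != phi6 W R j z.
  case: i => -[|[|[|[|//]]]] ?; case: j => -[|[|[|[|//]]]] ? ij;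
    first [ by move: ij; rewrite -val_eqE
          | by exists eta; rewrite // !phi_eta
          | by exists eta; rewrite // !phi_eta eq_sym
          | by exists th; rewrite // !phi_th ].
(* [th] itself separates all the primes except the two where it vanishes, and T = X (X - 1)(X +
   1)(X^2 + 1) lists its residues, 0 once. *)
apply: (@conclusion6 _ _ _ W0 R0 two_table gth dimK c4 Lmax separate th eta ('X^5 - 'X) l0 l1) => //.
- by rewrite coefB coefXn coefX.
- by rewrite -!/(phi6 W R _ _) !phi_th.
- by rewrite -!/(phi6 W R _ _) !phi_eta.
- rewrite -/(phi6 W R _ _) phi_th derivB derivXn derivX rmorphB rmorph1 /= /vals /= hornerD.
  by rewrite hornerN hornerC horner_coef0 coef_map coefMn coefXn.
move=> g sg [x Lx gx].
have gE : comb6 W [:: g`_0 - 3 * (P * b' * g`_5); g`_1 - (3 * (3 * a') - 1) * g`_5;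
    g`_2; g`_3; g`_4; 3 * (P * g`_5)] = x *+ 3.
  by rewrite -gx horner6 // E1 /comb6 /=; ring.
have z := comb6_pmul W0 two_table gth dimK Lx gE.
apply: (@poly_mod_scale 3 isT g ('X^5 - 'X) g`_5 6) => //.
  by rewrite (leq_trans (size_polyD _ _)) // size_polyN size_polyXn size_polyX.
apply: forall_ltn6; rewrite !coefB !coefXn !coefX /=.
- by rewrite subrr mulr0 -[RHS](z 0%N isT); f3.
- transitivity ((g`_1 - (3 * (3 * a') - 1) * g`_5)%:~R - (g`_5)%:~R : 'F_3); first by f3.
  by rewrite (z 1%N isT) sub0r sub0r mulrN1 mulrNz.
- by rewrite (z 2%N isT) subrr mulr0.
- by rewrite (z 3%N isT) subrr mulr0.
- by rewrite (z 4%N isT) subrr mulr0.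
- by rewrite subr0 mulr1.
Qed.
End CaseTwo.

(** * The case m = 3: two unramified primes and two of ramification index two *)

(* The third and fourth rows of R both send th to -1; the idempotent zt of the ramified prime
   separates them. The uniformizers of the two ramified primes are rho, where th = 0, and
   th * (th + 1), where th = -1. *)
Section CaseThree.
Context (K : fieldExtType rat) (th zt rho eta : K) (A1 b' c2 d : int).
Context (gth : <<1; th>>%VS = fullv :> {vspace K}) (dimK : \dim {:K} = 6%N).
Context (A10 : A1 != 0) (b'3 : (b'%:~R : 'F_3) != 0) (A13 : ((A1 + 1)%:~R : 'F_3) != 0).
Local Notation A := (3 * A1).
Local Notation a := (1 + 3 * (3 * (1 - d))).
Local Notation u := (-1 + 3 * (1 + d)).
Local Notation t := (1 + 3 * d).
Local Notation q := (1 + 3 * (d + d * d)).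
Local Notation s := (1 + 3 * (1 + d * d)).
Context (E0 : th ^+ 3 = zt *~ 3 - th ^+ 2 *~ u - th *~ t).
Context (E1 : rho *~ A = th ^+ 4 + th *~ a).
Context (E2 : th * rho = eta *~ (3 * A) - (3 * A * b')%:~R).
Context (E3 : th * eta = - (3 * A * c2)%:~R).

Let A0 : A != 0. Proof. by rewrite mulf_neq0. Qed.
Let A30 : 3 * A != 0. Proof. by rewrite mulf_neq0. Qed.
Let n30 : 3 != 0 :> int. Proof. by []. Qed.

Let zt3 : zt *~ 3 = th ^+ 3 + th ^+ 2 *~ u + th *~ t.
Proof. by rewrite E0; ring. Qed.

(** The constants q and s arise here: once th^3 is reduced, the coefficients t - u^2 and a + u t are
    - 3 q and 3 s, so that dividing by 3 stays in the lattice. *)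
Lemma three_thz : th * zt = rho *~ A1 + zt *~ u - th ^+ 2 *~ q - th *~ s.
Proof.
apply: (cancel_mulz n30); rewrite -mulrzAr zt3.
transitivity ((th ^+ 4 + th *~ a) - th *~ a + th ^+ 3 *~ u + th ^+ 2 *~ t); first by ring.
by rewrite -E1 E0; ring.
Qed.

Lemma three_thhz : th ^+ 2 * zt = - (3 * A1 * A * b')%:~R + th *~ (-1 + 3 * (-2 - 2 * d + 2 * d * d))
  - th ^+ 2 *~ s + zt *~ t + rho *~ (u * A1) + eta *~ (3 * A1 * A).
Proof.
rewrite expr2 -mulrA three_thz.
transitivity ((th * rho) *~ A1 + (th * zt) *~ u - th ^+ 3 *~ q - th ^+ 2 *~ s); first by ring.
by rewrite E2 three_thz E0; ring.
Qed.

Lemma three_zz : zt ^+ 2 = (3 * (-2 * u * A1 * A1 * b' - A1 * A * A * c2))%:~R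
  + th *~ (3 * (- A1 * A1 * b' - 2 - 5 * d - d * d + d * d * d))
  + th ^+ 2 *~ (3 * (-1 - 2 * d - 2 * d * d - 2 * d * d * d))
  + zt *~ (1 + 3 * (-1 + 3 * d + 2 * d * d)) + rho *~ (A1 * (2 + 6 * d + 3 * d * d))
  + eta *~ (3 * (2 * u * A1 * A1)).
Proof.
apply: (cancel_mulz n30); rewrite expr2 -mulrzAr zt3.
transitivity (th * (th ^+ 2 * zt) + (th ^+ 2 * zt) *~ u + (th * zt) *~ t); first by ring.
rewrite three_thhz.
transitivity (- th *~ (3 * A1 * A * b') + th ^+ 2 *~ (-1 + 3 * (-2 - 2 * d + 2 * d * d))
  - th ^+ 3 *~ s + (th * zt) *~ t + (th * rho) *~ (u * A1) + (th * eta) *~ (3 * A1 * A) +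
  (- (3 * A1 * A * b')%:~R + th *~ (-1 + 3 * (-2 - 2 * d + 2 * d * d))
  - th ^+ 2 *~ s + zt *~ t + rho *~ (u * A1) + eta *~ (3 * A1 * A)) *~ u + (th * zt) *~ t).
  by ring.
by rewrite three_thz E2 E3 E0; ring.
Qed.

Let thhr : th * (th * rho) = - (9 * A * A * c2)%:~R - th *~ (3 * A * b').
Proof. by rewrite E2 mulrBr mulrzAr E3; ring. Qed.

Lemma three_zr : zt * rho = - (A * (3 * u * A * c2 + t * b'))%:~R - th *~ (A * (3 * A * c2 + u * b'))
  - th ^+ 2 *~ (A * b') + eta *~ (A * t).
Proof.
apply: (cancel_mulz n30); rewrite -mulrzAl zt3.
transitivity (th * (th * (th * rho)) + (th * (th * rho)) *~ u + (th * rho) *~ t); first by ring.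
by rewrite thhr E2; ring.
Qed.

Lemma three_ze : zt * eta = - (A * c2 * t)%:~R - th *~ (A * c2 * u) - th ^+ 2 *~ (A * c2).
Proof.
apply: (cancel_mulz n30); rewrite -mulrzAl zt3.
transitivity ((th * eta) * (th ^+ 2 + th *~ u + t%:~R)); first by ring.
by rewrite E3; ring.
Qed.

Lemma three_rr : rho ^+ 2 = (- (b' * a)%:~R + th *~ (b' * t) + th ^+ 2 *~ (- (3 * A * c2) + b' * u)
  - zt *~ (3 * b') + eta *~ a) *~ 3.
Proof.
apply: (cancel_mulz A0); rewrite expr2 -mulrzAl E1.
transitivity (th ^+ 3 * (th * rho) + (th * rho) *~ a); first by ring.
rewrite E2; transitivity (th ^+ 2 * (th * eta) *~ (3 * A) - th ^+ 3 *~ (3 * A * b')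
  + (eta *~ (3 * A) - (3 * A * b')%:~R) *~ a); first by ring.
by rewrite E3 E0; ring.
Qed.

Lemma three_re : rho * eta = (- (c2 * a)%:~R + th *~ (c2 * t) + th ^+ 2 *~ (c2 * u) - zt *~ (3 * c2)) *~ 3.
Proof.
apply: (cancel_mulz A0); rewrite -mulrzAl E1.
transitivity ((th * eta) * (th ^+ 3 + a%:~R)); first by ring.
by rewrite E3 E0; ring.
Qed.

Lemma three_ee : eta ^+ 2 = eta *~ b' - rho *~ c2.
Proof.
apply: (cancel_mulz A30).
transitivity ((eta *~ (3 * A) - (3 * A * b')%:~R) * eta + eta *~ (3 * A * b')); first by ring.
by rewrite -E2 mulrAC E3; ring.
Qed.

Local Notation W := [:: 1; th; th ^+ 2; zt; rho; eta].
Local Notation bb := (b'%:~R : 'F_3).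
Local Notation R := [:: [:: 1; 0; 0; 0; 0; bb]; [:: 1; 0; 0; 0; 0; 0];
                        [:: 1; -1; 1; 0; 0; 0]; [:: 1; -1; 1; 1; 0; 0]].

Lemma three_table i j : (i <= j)%N -> (j < 6)%N -> exists2 c : seq int, W`_i * W`_j = comb6 W c &
     forall l, (l < 4)%N -> val6 (nth [::] R l) c = (nth [::] R l)`_i * (nth [::] R l)`_j.
Proof.
case: i => [|[|[|[|[|[|i]]]]]]; case: j => [|[|[|[|[|[|j]]]]]] //= _ _.
- tab [:: 1 : int].
- tab [:: 0; 1 : int].
- tab [:: 0; 0; 1 : int].
- tab [:: 0; 0; 0; 1 : int].
- tab [:: 0; 0; 0; 0; 1 : int].
- tab [:: 0; 0; 0; 0; 0; 1 : int].
- tab [:: 0; 0; 1 : int].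
- tab [:: 0; - t; -2 + 3 * (- d); 3].
  by rewrite -exprS E0; ring.
- tab [:: 0; - s; - q; u; A1].
  by rewrite three_thz; ring.
- tab [:: - (3 * A * b'); 0; 0; 0; 0; 3 * A].
  by rewrite E2; ring.
- tab [:: - (3 * A * c2)].
  by rewrite E3; ring.
- tab [:: 0; - a; 0; 0; A].
  by rewrite (_ : _ * _ = (th ^+ 4 + th *~ a) - th *~ a); [rewrite -E1 | ]; ring.
- tab [:: - (3 * A1 * A * b'); -1 + 3 * (-2 - 2 * d + 2 * d * d); - s; t; u * A1; 3 * A1 * A].
  by rewrite three_thhz; ring.
- tab [:: - (3 * (3 * A * A * c2)); - (3 * A * b')].
  by rewrite expr2 -mulrA thhr; ring.
- tab [:: 0; - (3 * A * c2)].
  by rewrite expr2 -mulrA E3; ring.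
- tab [:: 3 * (-2 * u * A1 * A1 * b' - A1 * A * A * c2); 3 * (- A1 * A1 * b' - 2 - 5 * d - d * d + d * d * d);
    3 * (-1 - 2 * d - 2 * d * d - 2 * d * d * d); 1 + 3 * (-1 + 3 * d + 2 * d * d);
    A1 * (2 + 6 * d + 3 * d * d); 3 * (2 * u * A1 * A1)].
  by rewrite -expr2 three_zz; ring.
- tab [:: - (A * (3 * u * A * c2 + t * b')); - (A * (3 * A * c2 + u * b')); - (A * b'); 0; 0; A * t].
  by rewrite three_zr; ring.
- tab [:: - (A * c2 * t); - (A * c2 * u); - (A * c2)].
  by rewrite three_ze; ring.
- tab [:: 3 * (- (b' * a)); 3 * (b' * t); 3 * (- (3 * A * c2) + b' * u); 3 * (- (3 * b')); 0; 3 * a].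
  by rewrite -expr2 three_rr; ring.
- tab [:: 3 * (- (c2 * a)); 3 * (c2 * t); 3 * (c2 * u); 3 * (- (3 * c2))].
  by rewrite three_re; ring.
- tab [:: 0; 0; 0; 0; - c2; b'].
  by rewrite -expr2 three_ee; ring.
Qed.

Local Notation L := (Zspan (gens W)).
Let W0 : gens W ord0 = 1. Proof. by []. Qed.
Let R0 l : vals R l ord0 = 1. Proof. by case: l => -[|[|[|[|]]]]. Qed.
Let l0 : 'I_4 := Ordinal (isT : (0 < 4)%N).
Let l1 : 'I_4 := Ordinal (isT : (1 < 4)%N).
Let l2 : 'I_4 := Ordinal (isT : (2 < 4)%N).
Let l3 : 'I_4 := Ordinal (isT : (3 < 4)%N).
Local Notation phi := (phi6 W R).
Local Notation Z z := (z%:~R : 'F_3).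

Let combE l c : phi l (comb6 W c) = val6 (nth [::] R l) c.
Proof. exact: (phi6_comb W0 three_table gth dimK). Qed.
Let combL c : L (comb6 W c). Proof. exact: comb6_order. Qed.

Let phi_l1 c : phi l1 (comb6 W c) = Z c`_0.
Proof. by rewrite combE /val6 /=; ring. Qed.
Let phi_l3 c : phi l3 (comb6 W c) = Z (c`_0 - c`_1 + c`_2 + c`_3).
Proof. by rewrite combE /val6 /=; ring. Qed.

(** The vanishing of 3 x at the four primes is a linear system over F_3, whose solutions are spanned
    by the uniformizers of the two ramified primes. *)
Lemma three_radical x : integralOver (intr : int -> K) x -> L (x *+ 3) ->
  exists z z' q, L q /\ x *+ 3 = rho *~ z + (th + th ^+ 2) *~ z' + q *+ 3.
Proof.
move=> ix Lx; have [z0 [z1 [z2 [z3 [z4 [z5 xE]]]]]] := order_comb6 Lx.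
have v l : phi l (x *+ 3) = 0 := phi6_integral W0 R0 three_table gth dimK l ix Lx.
have h0 : Z z0 = 0 by rewrite -[RHS](v l1) xE combE /val6 /=; ring.
have v0 : Z z0 + Z z5 * bb = 0 by rewrite -[RHS](v l0) xE combE /val6 /=; ring.
have v2 : Z z0 - Z z1 + Z z2 = 0 by rewrite -[RHS](v l2) xE combE /val6 /=; ring.
have v3 : Z z0 - Z z1 + Z z2 + Z z3 = 0 by rewrite -[RHS](v l3) xE combE /val6 /=; ring.
have h5 : Z z5 = 0 by apply: (mulIf b'3); rewrite mul0r -[RHS]v0 h0 add0r.
have h3 : Z z3 = 0 by rewrite -[RHS]v3 v2 add0r.
have h2 : Z (z2 - z1) = 0 by rewrite -[RHS]v2 h0; ring.
have dv (z : int) : Z z = 0 -> exists m, z = m * 3.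
  by move=> /eqP; rewrite intF3_eq0 => /dvdzP.
have [m0 e0] := dv _ h0; have [m2 e2] := dv _ h2; have [m3 e3] := dv _ h3.
have [m5 e5] := dv _ h5; have {}e2 : z2 = m2 * 3 + z1 by rewrite -e2 subrK.
exists z4, z1, (comb6 W [:: m0; 0; m2; m3; 0; m5]); split; first exact: combL.
by rewrite xE e0 e2 e3 e5 /comb6 /=; ring.
Qed.

Let tau := comb6 W [:: - (b' * a); b' * t; - (3 * A * c2) + b' * u; - (3 * b'); 0; a].
Let tau' := comb6 W [:: 0; -4 + d; -1 - 2 * d; 2; A1].
Let sigma := comb6 W [:: - (A * b') - 3 * A * A * c2; - (A * b'); 0; 0; 0; A].

Let rho2 : rho ^+ 2 = tau *+ 3.
Proof. by rewrite three_rr /tau /comb6 /=; ring. Qed.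

Let pi2 : (th + th ^+ 2) ^+ 2 = tau' *+ 3.
Proof.
transitivity (th ^+ 2 + th ^+ 3 *+ 2 + (th ^+ 4 + th *~ a) - th *~ a); first by ring.
by rewrite E0 -E1 /tau' /comb6 /=; ring.
Qed.

Let rhopi : rho * (th + th ^+ 2) = sigma *+ 3.
Proof.
transitivity (th * rho + th * (th * rho)); first by ring.
by rewrite thhr E2 /sigma /comb6 /=; ring.
Qed.

Lemma three_gens : [/\ L th, L eta, L rho, L zt & [/\ forall l, phi l th = vals R l (lift ord0 ord0),
  forall l, phi l eta = vals R l ord_max, forall l, phi l rho = 0 &
  forall l, phi l zt = vals R l (Ordinal (isT : (3 < 6)%N))]].
Proof.
split; try exact: (Zspan_gen (gens W) (Ordinal (isT : (1 < 6)%N)));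
  try exact: (Zspan_gen (gens W) (Ordinal (isT : (3 < 6)%N)));
  try exact: (Zspan_gen (gens W) (Ordinal (isT : (4 < 6)%N)));
  try exact: (Zspan_gen (gens W) (Ordinal (isT : (5 < 6)%N))).
split=> l.
- exact: (phi6_gen W0 three_table gth dimK l (lift ord0 ord0)).
- exact: (phi6_gen W0 three_table gth dimK l ord_max).
- rewrite [LHS](phi6_gen W0 three_table gth dimK l (Ordinal (isT : (4 < 6)%N))).
  by case: l => -[|[|[|[|//]]]].
exact: (phi6_gen W0 three_table gth dimK l (Ordinal (isT : (3 < 6)%N))).
Qed.

Let nz (k : int) : Z k = 1 \/ Z k = -1 -> Z k != 0.
Proof. by case=> ->; rewrite ?oppr_eq0 oner_eq0. Qed.

Lemma three_maximal x : integralOver (intr : int -> K) x -> L (x *+ 3) -> L x.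
Proof.
move=> ix Lx; have [Lth _ Lrho _ _] := three_gens.
have Lpi : L (th + th ^+ 2).
  by apply: ZspanD => //; rewrite expr2; apply: (order6M three_table).
apply: (order6_maximal_quadratic W0 R0 three_table gth dimK (l := l1) (l' := l3)
  Lrho Lpi (combL _) (combL _) (combL _) rho2 pi2 rhopi _ _ _ _ _ _ ix (three_radical ix Lx)).
- rewrite phi_l1 /=; have -> : Z (- (b' * a)) = - bb by f3.
  by rewrite oppr_eq0.
- by rewrite phi_l1.
- by rewrite phi_l1 /=; f3.
- rewrite phi_l3 /=; apply: nz; right.
  have -> : 0 - (-4 + d) + (-1 - 2 * d) + 2 = -1 + 3 * (2 - d) by ring.
  by f3.
- rewrite phi_l3 /=.
  have -> : - (b' * a) - b' * t + (- (3 * A * c2) + b' * u) + - (3 * b') =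
    3 * (b' * (-4 + 3 * d) - A * c2) by ring.
  by f3.
by rewrite phi_l3 /=; f3.
Qed.

Lemma conclusion_three : vp 3 (field_index K)%:Z = 1%N /\ ~ monogenic K.
Proof.
have [Lth Leta Lrho Lzt [phi_th phi_eta phi_rho phi_zt]] := three_gens.
(* mu and mu' are a0 rho / 3 and (a0 - 1)(th + th^2) / 3. Being units at l1 and l3, they show that
   a0 and a0 - 1 are uniformizers at the two ramified primes. In a0, - eta^2 moves the value at l0
   from 0 to -1, that of l2; - zt moves the value at l3 from -1 to 1. *)
pose mu := comb6 W [:: - (A * b') + A1 * (3 * u * A * c2 + t * b') - (c2 - 1) * (b' * a) + b' * c2 * a;
  A1 * (3 * A * c2 + u * b') + (c2 - 1) * b' * t - b' * c2 * t;
  A1 * b' + (c2 - 1) * (- (3 * A * c2) + b' * u) - b' * c2 * u;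
  - (3 * b' * (c2 - 1)) + 3 * b' * c2; 0; A - A1 * t + (c2 - 1) * a].
pose mu' := comb6 W [:: A1 * A * b' + (c2 - 1) * (- (A * b') - 3 * A * A * c2) + b' * A * c2;
  3 + d - d * d + (c2 - 1) * (- (A * b')) + b' * A * c2; 1 + 2 * d * d; - (2 * d);
  - (A1 * (1 + d)); - (A1 * A) + (c2 - 1) * A].
(* a0 = th - eta ^+ 2 - zt - rho *)
pose a0 := comb6 W [:: 0; 1; 0; -1; c2 - 1; - b'].
have a0E : a0 = th - zt + rho *~ (c2 - 1) - eta *~ b' by rewrite /a0 /comb6 /=; ring.
have La0 : L a0 := combL _.
have Lmu : L mu := combL _.
have Lmu' : L mu' := combL _.
have Lpi : L (th + th ^+ 2).
  by apply: ZspanD => //; rewrite expr2; apply: (order6M three_table).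
have a0rho : (a0 - 0%:~R) * rho = mu *+ 3.
  rewrite a0E; transitivity (th * rho - zt * rho + rho ^+ 2 *~ (c2 - 1) - (rho * eta) *~ b').
    by ring.
  by rewrite E2 three_zr three_rr three_re /mu /comb6 /=; ring.
have a0pi : (a0 - 1%:~R) * (th + th ^+ 2) = mu' *+ 3.
  rewrite a0E; transitivity (th ^+ 3 - th - (th * zt + th ^+ 2 * zt)
    + (rho * (th + th ^+ 2)) *~ (c2 - 1) - (th * eta + th * (th * eta)) *~ b'); first by ring.
  by rewrite rhopi E3 three_thhz three_thz E0 /mu' /sigma /comb6 /=; ring.
have a0_0 : phi l0 a0 = -1.
  by rewrite /a0 combE /val6 /=; rewrite -[in RHS](F3_sqr b'3); ring.
have a0_1 : phi l1 a0 = 0%:~R by rewrite /a0 phi_l1.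
have a0_2 : phi l2 a0 = -1 by rewrite /a0 combE /val6 /=; ring.
have a0_3 : phi l3 a0 = 1%:~R by rewrite /a0 phi_l3 /=; apply/eqP.
have mu_unit : phi l1 mu != 0.
  rewrite phi_l1 /=; set k := (X in Z X).
  have -> : Z k = bb * Z (A1 + 1) by rewrite /k; f3.
  by rewrite mulf_neq0.
have mu'_unit : phi l3 mu' != 0.
  rewrite phi_l3 /=; apply: nz; left; set k := (X in Z X).
  have -> : k = 1 + 3 * (-1 - d + d * d + A1 * A1 * b' + (c2 - 1) * (- (A1 * b') - A * A * c2)
     + (c2 - 1) * A1 * b') by rewrite /k; ring.
  by f3.
have pi_l3 : phi l3 (th + th ^+ 2) = 0.
  have -> : th + th ^+ 2 = comb6 W [:: 0; 1; 1] by rewrite /comb6 /=; ring.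
  by rewrite phi_l3.
have c4 : (3 < #|'I_4|)%N by rewrite card_ord.
have separate i j : i != j -> exists2 z, L z & phi i z != phi j z.
  case: i => -[|[|[|[|//]]]] ?; case: j => -[|[|[|[|//]]]] ? ij;
    first [ by move: ij; rewrite -val_eqE
          | by exists eta; rewrite // !phi_eta
          | by exists eta; rewrite // !phi_eta eq_sym
          | by exists th; rewrite // !phi_th
          | by exists zt; rewrite // !phi_zt ].
(* T = X^2 (X - 1)^2 (X + 1): a double root for each ramified prime, and the simple root -1 shared
   by the two unramified ones. *)
pose T : {poly int} := 'X^5 - 'X^4 - 'X^3 + 'X^2.
have TE i : T`_i = (i == 5%N)%:R - (i == 4%N)%:R - (i == 3%N)%:R + (i == 2%N)%:R.
  by rewrite /T coefD !coefB !coefXn.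
have sT : (size T <= 6)%N.
  apply/leq_sizeP => i i6; rewrite TE.
  by case: i i6 => [|[|[|[|[|[|i]]]]]].
apply: (@conclusion6 _ _ _ W0 R0 three_table gth dimK c4 three_maximal separate a0 eta T l0 l2) => //.
- by rewrite -!/(phi6 W R _ _) a0_0 a0_2.
- by rewrite -!/(phi6 W R _ _) !phi_eta.
- rewrite -/(phi6 W R _ _) a0_0 horner6; last by rewrite (leq_trans (size_poly _ _)) // (leq_trans (leq_pred _)).
  by rewrite !coef_deriv !TE.
move=> f sf [x Lx fx].
pose G (i : nat) : 'F_3 := (f`_i)%:~R.
have root l := simple_root6 W0 R0 three_table gth dimK l La0 Lx fx.
have e1 : G 0%N = 0 by rewrite -[RHS](root l1) a0_1 horner6 // /G; ring.
have e3 : G 0%N + G 1%N + G 2%N + G 3%N + G 4%N + G 5%N = 0.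
  by rewrite -[RHS](root l3) a0_3 horner6 // /G; ring.
have e0 : G 0%N - G 1%N + G 2%N - G 3%N + G 4%N - G 5%N = 0.
  by rewrite -[RHS](root l0) a0_0 horner6 // /G; ring.
have e1' : G 1%N = 0.
  have := double_root6 W0 R0 three_table gth dimK La0 Lx Lrho Lmu fx a0_1 (phi_rho l1) a0rho mu_unit.
  by rewrite horner_coef0 coef_map coef_deriv.
have e3' : G 1%N + 2 * G 2%N + 3 * G 3%N + 4 * G 4%N + 5 * G 5%N = 0.
  have := double_root6 W0 R0 three_table gth dimK La0 Lx Lpi Lmu' fx a0_3 pi_l3 a0pi mu'_unit.
  rewrite horner6; last by rewrite (leq_trans (size_poly _ _)) // (leq_trans (leq_pred _)).
  move=> <-; rewrite !coef_deriv (nth_default _ sf) /G; ring.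
have e4 : G 4%N = - G 2%N.
  apply/eqP; rewrite -addr_eq0; apply/eqP; apply: (mulfI F3_two); rewrite mulr0.
  transitivity ((G 0%N + G 1%N + G 2%N + G 3%N + G 4%N + G 5%N)
    + (G 0%N - G 1%N + G 2%N - G 3%N + G 4%N - G 5%N)); first by rewrite e1; ring.
  by rewrite e0 e3 addr0.
have e5 : G 3%N = - G 5%N.
  by apply/eqP; rewrite -addr_eq0 -e3 e1 e1' e4; apply/eqP; ring.
have e2 : G 2%N = G 5%N.
  apply: (mulfI F3_two); apply/eqP; rewrite eq_sym -subr_eq0 -e3' e1' e4 e5; apply/eqP; ring.
apply: (@poly_mod_scale 3 isT f T f`_5 6) => //.
apply: forall_ltn6; rewrite TE /=.
- by rewrite [LHS]e1; ring.
- by rewrite [LHS]e1'; ring.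
- by rewrite [LHS]e2 /G; ring.
- by rewrite [LHS]e5 /G; ring.
- by rewrite [LHS]e4 e2 /G; ring.
- by ring.
Qed.
End CaseThree.

(** * The case m = 4: three unramified primes and one of ramification index three *)

(* g is 1 or 3 according to v_3(b) mod 3, and g' = 3 / g. The ramified prime has index 3 and
   uniformizer r1 if g = 1, r2 if g = 3; the other one of the two has valuation 2/3. *)
Section CaseFour.
Context (K : fieldExtType rat) (th r1 r2 eta : K) (A B g g' b' c2 a' : int).
Context (gth : <<1; th>>%VS = fullv :> {vspace K}) (dimK : \dim {:K} = 6%N).
Context (A0 : A != 0) (b'3 : (b'%:~R : 'F_3) != 0) (gg : g * g' = 3) (gA : g * A = 3 * B).
Context (E1 : r1 *~ A = th ^+ 3 + th *~ (9 * a' - 1)).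
Context (E2 : th * r1 = r2 *~ (3 * B)).
Context (E3 : th * r2 = eta *~ (3 * A) - (3 * A * b')%:~R).
Context (E4 : th * eta = - (3 * A * c2)%:~R).

Let g0 : g != 0. Proof. by apply/eqP => h; move: gg; rewrite h mul0r. Qed.
Let B0 : 3 * B != 0. Proof. by rewrite -gA mulf_neq0. Qed.
Let A30 : 3 * A != 0. Proof. by rewrite mulf_neq0. Qed.
Let gA' : 3 * B * g' = 3 * A. Proof. by rewrite -gA mulrAC gg. Qed.

Lemma four_r12 : r1 * r2 = (eta - b'%:~R) *~ (3 * (9 * a' - 1)) - (th *~ (3 * A * c2) + th ^+ 2 *~ b') *~ 3.
Proof.
apply: (cancel_mulz A0); rewrite -mulrzAl E1.
transitivity (th * (th * (th * r2)) + (th * r2) *~ (9 * a' - 1)); first by ring.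
rewrite E3; transitivity (th * (th * eta) *~ (3 * A) - th ^+ 2 *~ (3 * A * b') +
  (eta *~ (3 * A) - (3 * A * b')%:~R) *~ (9 * a' - 1)); first by ring.
by rewrite E4; ring.
Qed.

Lemma four_r11 : r1 ^+ 2 = (r2 *~ (9 * a' - 1) - (th *~ b' + (3 * A * c2)%:~R) *~ (3 * A)) *~ g.
Proof.
apply: (cancel_mulz A0); rewrite -mulrzA gA expr2 -mulrzAl E1.
transitivity (th * (th * (th * r1)) + (th * r1) *~ (9 * a' - 1)); first by ring.
rewrite E2; transitivity (th * (th * r2) *~ (3 * B) + r2 *~ (3 * B * (9 * a' - 1))); first by ring.
rewrite E3; transitivity ((th * eta) *~ (3 * A * (3 * B)) - th *~ (3 * A * b' * (3 * B))
  + r2 *~ (3 * B * (9 * a' - 1))); first by ring.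
by rewrite E4; ring.
Qed.

Lemma four_r22 : r2 ^+ 2 = - (r1 *~ b' + (th ^+ 2 + (9 * a' - 1)%:~R) *~ (3 * c2)) *~ g'.
Proof.
apply: (cancel_mulz B0); rewrite -mulrzA [g' * _]mulrC gA' expr2 -mulrzAl -E2 -mulrA four_r12.
transitivity ((th * eta - th *~ b') *~ (3 * (9 * a' - 1)) - (th ^+ 2 *~ (3 * A * c2)) *~ 3
  - (th ^+ 3 + th *~ (9 * a' - 1) - th *~ (9 * a' - 1)) *~ (b' * 3)); first by ring.
by rewrite -E1 E4; ring.
Qed.

Lemma four_r1e : r1 * eta = - (th ^+ 2 + (9 * a' - 1)%:~R) *~ (3 * c2).
Proof.
apply: (cancel_mulz A0); rewrite -mulrzAl E1.
transitivity ((th * eta) * (th ^+ 2 + (9 * a' - 1)%:~R)); first by ring.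
by rewrite E4; ring.
Qed.

Lemma four_r2e : r2 * eta = - r1 *~ (g' * c2).
Proof.
apply: (cancel_mulz B0).
rewrite -mulrzA (_ : g' * c2 * (3 * B) = 3 * B * g' * c2); last by ring.
rewrite gA' -mulrzAl -E2 mulrAC E4; ring.
Qed.

Lemma four_ee : eta ^+ 2 = eta *~ b' - r2 *~ c2.
Proof.
apply: (cancel_mulz A30).
transitivity ((eta *~ (3 * A) - (3 * A * b')%:~R) * eta + eta *~ (3 * A * b')); first by ring.
by rewrite -E3 mulrAC E4; ring.
Qed.

Local Notation W := [:: 1; th; th ^+ 2; r1; r2; eta].
Local Notation bb := (b'%:~R : 'F_3).
Local Notation R := [:: [:: 1; 0; 0; 0; 0; bb]; [:: 1; 0; 0; 0; 0; 0];
                        [:: 1; 1; 1; 0; 0; 0]; [:: 1; -1; 1; 0; 0; 0]].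

Lemma four_table i j : (i <= j)%N -> (j < 6)%N -> exists2 c : seq int, W`_i * W`_j = comb6 W c &
     forall l, (l < 4)%N -> val6 (nth [::] R l) c = (nth [::] R l)`_i * (nth [::] R l)`_j.
Proof.
have th3 : th ^+ 3 = r1 *~ A - th *~ (9 * a' - 1) by rewrite E1 addrK.
case: i => [|[|[|[|[|[|i]]]]]]; case: j => [|[|[|[|[|[|j]]]]]] //= _ _.
- tab [:: 1 : int].
- tab [:: 0; 1 : int].
- tab [:: 0; 0; 1 : int].
- tab [:: 0; 0; 0; 1 : int].
- tab [:: 0; 0; 0; 0; 1 : int].
- tab [:: 0; 0; 0; 0; 0; 1 : int].
- tab [:: 0; 0; 1 : int].
- tab [:: 0; 1 + 3 * (- (3 * a')); 0; A].
  by rewrite -exprS th3; ring.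
- tab [:: 0; 0; 0; 0; 3 * B].
  by rewrite E2; ring.
- tab [:: - (3 * (A * b')); 0; 0; 0; 0; 3 * A].
  by rewrite E3; ring.
- tab [:: - (3 * (A * c2))].
  by rewrite E4; ring.
- tab [:: 0; 0; 1 + 3 * (- (3 * a')); 0; 3 * (A * B)].
  by rewrite (_ : _ * _ = th * th ^+ 3); [rewrite th3 mulrBr !mulrzAr E2 | ]; ring.
- tab [:: - (3 * (3 * A * B * b')); 0; 0; 0; 0; 3 * (3 * A * B)].
  by rewrite expr2 -mulrA E2 mulrzAr E3; ring.
- tab [:: - (3 * (3 * A * A * c2)); - (3 * (A * b'))].
  by rewrite expr2 -mulrA E3 mulrBr mulrzAr E4; ring.
- tab [:: 0; - (3 * (A * c2))].
  by rewrite expr2 -mulrA E4; ring.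
- tab [:: - (3 * (3 * g * A * A * c2)); - (3 * (g * A * b')); 0; 0; (9 * a' - 1) * g].
  by rewrite -expr2 four_r11; ring.
- tab [:: - (3 * (b' * (9 * a' - 1))); - (3 * (3 * A * c2)); - (3 * b'); 0; 0; 3 * (9 * a' - 1)].
  by rewrite four_r12; ring.
- tab [:: - (3 * (c2 * (9 * a' - 1))); 0; - (3 * c2)].
  by rewrite four_r1e; ring.
- tab [:: - (3 * (g' * c2 * (9 * a' - 1))); 0; - (3 * (g' * c2)); - (g' * b')].
  by rewrite -expr2 four_r22; ring.
- tab [:: 0; 0; 0; - (g' * c2)].
  by rewrite four_r2e; ring.
- tab [:: 0; 0; 0; 0; - c2; b'].
  by rewrite -expr2 four_ee; ring.
Qed.

Local Notation L := (Zspan (gens W)).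
Let W0 : gens W ord0 = 1. Proof. by []. Qed.
Let R0 l : vals R l ord0 = 1. Proof. by case: l => -[|[|[|[|]]]]. Qed.
Let l0 : 'I_4 := Ordinal (isT : (0 < 4)%N).
Let l1 : 'I_4 := Ordinal (isT : (1 < 4)%N).
Let l2 : 'I_4 := Ordinal (isT : (2 < 4)%N).
Let l3 : 'I_4 := Ordinal (isT : (3 < 4)%N).
Local Notation phi := (phi6 W R).
Local Notation Z z := (z%:~R : 'F_3).

Definition four_phi_comb l c : phi l (comb6 W c) = val6 (nth [::] R l) c :=
  phi6_comb W0 four_table gth dimK l c.

Lemma four_radical x : integralOver (intr : int -> K) x -> L (x *+ 3) ->
  exists z z' q, L q /\ x *+ 3 = r1 *~ z + r2 *~ z' + q *+ 3.
Proof.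
move=> ix Lx; have [z0 [z1 [z2 [z3 [z4 [z5 xE]]]]]] := order_comb6 Lx.
have v l : phi l (x *+ 3) = 0 := phi6_integral W0 R0 four_table gth dimK l ix Lx.
have h0 : Z z0 = 0 by rewrite -[RHS](v l1) xE four_phi_comb /val6 /=; ring.
have v0 : Z z0 + Z z5 * bb = 0 by rewrite -[RHS](v l0) xE four_phi_comb /val6 /=; ring.
have v2 : Z z0 + Z z1 + Z z2 = 0 by rewrite -[RHS](v l2) xE four_phi_comb /val6 /=; ring.
have v3 : Z z0 - Z z1 + Z z2 = 0 by rewrite -[RHS](v l3) xE four_phi_comb /val6 /=; ring.
have h5 : Z z5 = 0 by apply: (mulIf b'3); rewrite mul0r -[RHS]v0 h0 add0r.
have h1 : Z z1 = 0.
  apply: (mulfI F3_two); rewrite mulr0.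
  by transitivity ((Z z0 + Z z1 + Z z2) - (Z z0 - Z z1 + Z z2)); [ring | rewrite v2 v3 subr0].
have h2 : Z z2 = 0 by rewrite -[RHS]v2 h0 h1 !add0r.
have dv (z : int) : Z z = 0 -> exists m, z = m * 3.
  by move=> /eqP; rewrite intF3_eq0 => /dvdzP.
have [m0 e0] := dv _ h0; have [m1 e1] := dv _ h1; have [m2 e2] := dv _ h2; have [m5 e5] := dv _ h5.
exists z3, z4, (comb6 W [:: m0; m1; m2; 0; 0; m5]); split; first exact: comb6_order.
by rewrite xE e0 e1 e2 e5 /comb6 /=; ring.
Qed.

Lemma four_gens : [/\ L th, L eta, forall l, phi l th = vals R l (lift ord0 ord0) &
  forall l, phi l eta = vals R l ord_max].
Proof.
have thE : comb6 W [:: 0; 1] = th by rewrite /comb6 /=; ring.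
have etaE : comb6 W [:: 0; 0; 0; 0; 0; 1] = eta by rewrite /comb6 /=; ring.
have phi_th l : phi l th = vals R l (lift ord0 ord0).
  by have := four_phi_comb l [:: 0; 1]; rewrite thE => ->; rewrite /val6 /vals /=; ring.
have phi_eta l : phi l eta = vals R l ord_max.
  by have := four_phi_comb l [:: 0; 0; 0; 0; 0; 1]; rewrite etaE => ->; rewrite /val6 /vals /=; ring.
have Lth : L th by have := comb6_order W [:: 0; 1]; rewrite thE.
have Leta : L eta by have := comb6_order W [:: 0; 0; 0; 0; 0; 1]; rewrite etaE.
by [].
Qed.

(** [eta ^+ 2] moves the value at the first prime from 0 to b'^2 = 1, the value of [th] at the
    third; pi, chosen as the uniformizer, supplies the valuation 1/3 at the ramified prime. *)
Lemma four_generator (pi : K) : L pi -> (forall l, phi l pi = 0) ->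
  L (th + pi + eta ^+ 2) /\
  forall l, phi l (th + pi + eta ^+ 2) = vals R l (lift ord0 ord0) + vals R l ord_max ^+ 2.
Proof.
move=> Lpi pi0; have [Lth Leta phi_th phi_eta] := four_gens.
have Le2 : L (eta ^+ 2) by rewrite expr2; apply: (order6M four_table).
have Ltp : L (th + pi) by apply: ZspanD.
split=> [|l]; first exact: ZspanD.
rewrite (phi6D W0 four_table gth dimK) // (phi6D W0 four_table gth dimK) // expr2.
by rewrite (phi6M W0 four_table gth dimK) // phi_th phi_eta pi0 addr0.
Qed.

(** Common to both values of g, for which [r1] and [r2] exchange the roles of pi and pi2. That mu
    and nu are units at l1 means that a0 has valuation 1/3 there, so every relation modulo 3 has a
    triple root at 0. *)
Lemma conclusion_four_aux (pi pi2 tau sigma sigma' mu nu : K) : L pi -> L pi2 -> L tau ->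
  L sigma -> L sigma' -> L mu -> L nu -> (forall l, phi l pi = 0) -> phi l1 pi2 = 0 ->
  phi l1 sigma != 0 -> phi l1 sigma' != 0 -> phi l1 mu != 0 -> phi l1 nu != 0 ->
  pi * pi2 = tau *+ 3 -> pi ^+ 3 = sigma *+ 3 -> pi2 ^+ 3 = sigma' *+ 9 ->
  (th + pi + eta ^+ 2) * pi2 = mu *+ 3 -> (th + pi + eta ^+ 2) ^+ 2 * pi = nu *+ 3 ->
  (forall z z', exists u u', r1 *~ z + r2 *~ z' = pi *~ u + pi2 *~ u') ->
  vp 3 (field_index K)%:Z = 1%N /\ ~ monogenic K.
Proof.
move=> Lpi Lpi2 Ltau Ls Ls' Lmu Lnu pi0 pi20 s0 s'0 mu0 nu0 pipi2 pi3 pi23 amu anu swap.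
set a0 := th + pi + eta ^+ 2 in amu anu.
have Lmax x : integralOver (intr : int -> K) x -> L (x *+ 3) -> L x.
  move=> ix Lx.
  apply: (order6_maximal_cubic W0 R0 four_table gth dimK Lpi Lpi2 Ltau Ls Ls' (pi0 l1) pi20 s0 s'0
    pipi2 pi3 pi23 ix).
  have [z [z' [q [Lq ->]]]] := four_radical ix Lx.
  by have [u [u' ->]] := swap z z'; exists u, u', q.
have [Lth Leta phi_th phi_eta] := four_gens; have [La0 phi_a0] := four_generator Lpi pi0.
have c4 : (3 < #|'I_4|)%N by rewrite card_ord.
have separate i j : i != j -> exists2 z, L z & phi i z != phi j z.
  case: i => -[|[|[|[|//]]]] ?; case: j => -[|[|[|[|//]]]] ? ij;
    first [ by move: ij; rewrite -val_eqE
          | by exists eta; rewrite // !phi_eta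
          | by exists eta; rewrite // !phi_eta eq_sym
          | by exists th; rewrite // !phi_th ].
have a0_0 : phi l0 a0 = 1 by rewrite phi_a0 /vals /= add0r expr2 F3_sqr.
have a0_1 : phi l1 a0 = 0 by rewrite phi_a0 /vals /= add0r expr2 mulr0.
have a0_2 : phi l2 a0 = 1 by rewrite phi_a0 /vals /= expr2 mulr0 addr0.
have a0_3 : phi l3 a0 = -1 by rewrite phi_a0 /vals /= expr2 mulr0 addr0.
(* T = X^3 (X - 1)(X + 1): 0 is triple for the ramified prime, and the simple root 1 is shared by l0
   and l2. *)
apply: (@conclusion6 _ _ _ W0 R0 four_table gth dimK c4 Lmax separate a0 eta ('X^5 - 'X^3) l0 l2) => //.
- by rewrite coefB !coefXn.
- by rewrite -!/(phi6 W R _ _) a0_0 a0_2.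
- by rewrite -!/(phi6 W R _ _) !phi_eta.
- rewrite -/(phi6 W R _ _) a0_0 derivB !derivXn.
  have -> : map_poly intr ('X^4 *+ 5 - 'X^2 *+ 3) = 'X^4 *+ 5 - 'X^2 *+ 3 :> {poly 'F_3}.
    by rewrite rmorphB !rmorphMn /= !map_polyXn.
  by rewrite hornerD hornerN !hornerMn !hornerXn !expr1n.
move=> f sf [x Lx fx].
pose G (i : nat) : 'F_3 := (f`_i)%:~R.
have root l := simple_root6 W0 R0 four_table gth dimK l La0 Lx fx.
have e0 : G 0%N + G 1%N + G 2%N + G 3%N + G 4%N + G 5%N = 0.
  by rewrite -[RHS](root l0) a0_0 horner6 // /G; ring.
have e1 : G 0%N = 0 by rewrite -[RHS](root l1) a0_1 horner6 // /G; ring.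
have e3 : G 0%N - G 1%N + G 2%N - G 3%N + G 4%N - G 5%N = 0.
  by rewrite -[RHS](root l3) a0_3 horner6 // /G; ring.
have amu' : (a0 - 0%:~R) * pi2 = mu *+ 3 by rewrite subr0.
have e1' : G 1%N = 0.
  have := double_root6 W0 R0 four_table gth dimK (s := 0) La0 Lx Lpi2 Lmu fx a0_1 pi20 amu' mu0.
  by rewrite horner_coef0 coef_map coef_deriv.
have e2 : G 2%N = 0.
  exact: (triple_root6 W0 R0 four_table gth dimK La0 Lx Lpi Lnu fx a0_1 e1 e1' (pi0 l1) anu nu0).
have e4 : G 4%N = 0.
  apply: (mulfI F3_two); rewrite mulr0.
  transitivity ((G 0%N + G 1%N + G 2%N + G 3%N + G 4%N + G 5%N) + (G 0%N - G 1%N + G 2%N - G 3%N + G 4%N - G 5%N)).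
    by rewrite e1 e1' e2; ring.
  by rewrite e0 e3 addr0.
have e5 : G 3%N = - G 5%N.
  by apply/eqP; rewrite -addr_eq0 -e0 e1 e1' e2 e4; apply/eqP; ring.
apply: (@poly_mod_scale 3 isT f ('X^5 - 'X^3) f`_5 6) => //.
  by rewrite (leq_trans (size_polyD _ _)) // size_polyN !size_polyXn.
apply: forall_ltn6; rewrite !coefB !coefXn /=.
- by rewrite subrr mulr0 [LHS]e1.
- by rewrite subrr mulr0 [LHS]e1'.
- by rewrite subrr mulr0 [LHS]e2.
- by rewrite sub0r mulrN1 mulrNz [LHS]e5.
- by rewrite subrr mulr0 [LHS]e4.
- by rewrite subr0 mulr1.
Qed.

Local Notation a := (3 * (3 * a') - 1).
(** r1 r2 = 3 tau, r1^3 = 3 g cube1 and r2^3 = 3 g' cube2, with [cube1] and [cube2] units at the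
    ramified prime. As g g' = 3, one cube is 3 times a unit and the other 9 times a unit: valuations
    1/3 and 2/3. *)
Let tau := comb6 W [:: - (b' * a); - (3 * A * c2); - b'; 0; 0; a].
Let cube1 := comb6 W [:: - (a * a * b'); - (3 * A * c2 * a); - (a * b'); - (3 * A * A * c2);
  - (3 * A * B * b'); a * a].
Let cube2 := comb6 W [:: b' * b' * a + 3 * (3 * A * A * c2 * c2); 6 * A * c2 * b'; b' * b'; 0;
  - (c2 * a); - (a * b')].

Let phi_l1 c : phi l1 (comb6 W c) = Z c`_0.
Proof. by rewrite four_phi_comb /val6 /=; ring. Qed.

Let phi_r1 l : phi l r1 = 0.
Proof.
rewrite -[r1]/(gens W (Ordinal (isT : (3 < 6)%N))) (phi6_gen W0 four_table gth dimK).
by case: l => -[|[|[|[|//]]]].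
Qed.

Let phi_r2 l : phi l r2 = 0.
Proof.
rewrite -[r2]/(gens W (Ordinal (isT : (4 < 6)%N))) (phi6_gen W0 four_table gth dimK).
by case: l => -[|[|[|[|//]]]].
Qed.

Let Lr1 : L r1. Proof. exact: (Zspan_gen (gens W) (Ordinal (isT : (3 < 6)%N))). Qed.
Let Lr2 : L r2. Proof. exact: (Zspan_gen (gens W) (Ordinal (isT : (4 < 6)%N))). Qed.
Let combL c : L (comb6 W c). Proof. exact: comb6_order. Qed.

Let F3_unit (k : int) : Z k = bb \/ Z k = - bb -> Z k != 0.
Proof. by case=> ->; rewrite ?oppr_eq0. Qed.

Let r12E : r1 * r2 = tau *+ 3.
Proof. by rewrite four_r12 /tau /comb6 /=; ring. Qed.

Let th2r2 : th * (th * r2) = - (9 * A * A * c2)%:~R - th *~ (3 * A * b').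
Proof. by rewrite E3 mulrBr mulrzAr E4; ring. Qed.

Let r1cube : r1 ^+ 3 = (cube1 *~ g) *+ 3.
Proof.
rewrite exprS four_r11.
transitivity (((r1 * r2) *~ (9 * a' - 1) - (th * r1) *~ (3 * A * b') - r1 *~ (9 * A * A * c2)) *~ g).
  by ring.
by rewrite four_r12 E2 /cube1 /comb6 /=; ring.
Qed.

Let r2cube : r2 ^+ 3 = (cube2 *~ g') *+ 3.
Proof.
rewrite exprS four_r22.
transitivity (- ((r1 * r2) *~ b' + (th * (th * r2)) *~ (3 * c2) + r2 *~ ((9 * a' - 1) * (3 * c2))) *~ g').
  by ring.
by rewrite four_r12 th2r2 /cube2 /comb6 /=; ring.
Qed.

Let Ltau : L tau. Proof. exact: combL. Qed.
Let Lcube1 : L cube1. Proof. exact: combL. Qed.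
Let Lcube2 : L cube2. Proof. exact: combL. Qed.

Let cube1_unit : phi l1 cube1 != 0.
Proof.
rewrite phi_l1; apply: F3_unit; right; rewrite /=.
transitivity (- Z (b' * 1)); [f3 | by rewrite mulr1].
Qed.

Let cube2_unit : phi l1 cube2 != 0.
Proof.
rewrite phi_l1 /=; have -> : Z (b' * b' * a + 3 * (3 * A * A * c2 * c2)) = - (bb * bb) by f3.
by rewrite oppr_eq0 mulf_neq0.
Qed.

Lemma conclusion_four_1 : g = 1 -> vp 3 (field_index K)%:Z = 1%N /\ ~ monogenic K.
Proof.
move=> g1; have g3 : g' = 3 by rewrite -gg g1 mul1r.
have A3 : A = 3 * B by rewrite -gA g1 mul1r.
pose mu := comb6 W [:: - (3 * (B * b')) - b' * a + 3 * (c2 * c2 * a); - (3 * A * c2);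
  - b' + 3 * (c2 * c2); 0; 0; A + a].
pose kappa := comb6 W [:: - (3 * A * A * c2); - (A * b') + 3 * A * c2 * c2; 0; 0; 0; - (c2 * a)].
have a0r2 : (th + r1 + eta ^+ 2) * r2 = mu *+ 3.
  rewrite four_ee.
  transitivity (th * r2 + r1 * r2 + (r2 * eta) *~ b' - r2 ^+ 2 *~ c2); first by ring.
  by rewrite E3 four_r12 four_r2e four_r22 /mu /comb6 /= g3 A3; ring.
have a0r1 : (th + r1 + eta ^+ 2) * r1 = r2 *~ (a + A) + kappa *+ 3.
  rewrite four_ee.
  transitivity (th * r1 + r1 ^+ 2 + (r1 * eta) *~ b' - (r1 * r2) *~ c2); first by ring.
  by rewrite E2 four_r11 four_r1e four_r12 /kappa /comb6 /= g1 A3; ring.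
set a0 := th + r1 + eta ^+ 2 in a0r2 a0r1.
have [La0 phi_a0'] := four_generator Lr1 phi_r1.
have phi_a0 : phi l1 a0 = 0 by rewrite phi_a0' /vals /= add0r expr2 mulr0.
have Lmu : L mu := combL _.
have Lkappa : L kappa := combL _.
(* Multiplying r1 by a0 gives a unit times r2 modulo 3 L, and a second multiplication by a0 then
   gives 3 nu. *)
pose nu := mu *~ (a + A) + a0 * kappa.
have Lnu1 : L (mu *~ (a + A)) by apply: Zspan_mulz.
have Lnu2 : L (a0 * kappa) by apply: (order6M four_table).
have mu_unit : phi l1 mu != 0.
  by rewrite phi_l1 /=; apply: F3_unit; left; f3.
apply: (@conclusion_four_aux r1 r2 tau cube1 cube2 mu nu) => //.
- exact: ZspanD.
- rewrite /nu (phi6D W0 four_table gth dimK) // (phi6Mz W0 four_table gth dimK) //.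
  rewrite (phi6M W0 four_table gth dimK) // phi_a0 mul0r addr0 -mulrzr mulf_neq0 //.
  have -> : Z (a + A) = -1 by rewrite A3; f3.
  by rewrite oppr_eq0 oner_eq0.
- by rewrite r1cube g1 mulr1z.
- by rewrite r2cube g3; ring.
- by rewrite expr2 -mulrA a0r1 mulrDr mulrzAr a0r2 /nu -/a0; ring.
by move=> z z'; exists z, z'.
Qed.

Lemma conclusion_four_3 : g = 3 -> vp 3 (field_index K)%:Z = 1%N /\ ~ monogenic K.
Proof.
move=> g3; have g1 : g' = 1 by move: gg; rewrite g3; lia.
have AB : B = A by move: gA; rewrite g3; lia.
pose mu := comb6 W [:: - (b' * a); - (3 * A * c2 * (1 - c2)); - b'; 0; A; (1 - c2) * a].
pose kappa := comb6 W [:: - (A * b') - (1 - c2) * c2 * a; 0; - ((1 - c2) * c2); 0; 0; A].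
have a0r1 : (th + r2 + eta ^+ 2) * r1 = mu *+ 3.
  rewrite four_ee.
  transitivity (th * r1 + (r1 * r2) *~ (1 - c2) + (r1 * eta) *~ b'); first by ring.
  by rewrite E2 four_r12 four_r1e /mu /comb6 /= AB; ring.
have a0r2 : (th + r2 + eta ^+ 2) * r2 = - r1 *~ b' + kappa *+ 3.
  rewrite four_ee.
  transitivity (th * r2 + r2 ^+ 2 *~ (1 - c2) + (r2 * eta) *~ b'); first by ring.
  by rewrite E3 four_r22 four_r2e /kappa /comb6 /= g1; ring.
set a0 := th + r2 + eta ^+ 2 in a0r1 a0r2.
have [La0 phi_a0'] := four_generator Lr2 phi_r2.
have phi_a0 : phi l1 a0 = 0 by rewrite phi_a0' /vals /= add0r expr2 mulr0.
have Lmu : L mu := combL _.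
have Lkappa : L kappa := combL _.
pose nu := mu *~ (- b') + a0 * kappa.
have Lnu1 : L (mu *~ (- b')) by apply: Zspan_mulz.
have Lnu2 : L (a0 * kappa) by apply: (order6M four_table).
have mu_unit : phi l1 mu != 0.
  by rewrite phi_l1 /=; apply: F3_unit; left; f3.
apply: (@conclusion_four_aux r2 r1 tau cube2 cube1 mu nu) => //.
- exact: ZspanD.
- rewrite /nu (phi6D W0 four_table gth dimK) // (phi6Mz W0 four_table gth dimK) //.
  rewrite (phi6M W0 four_table gth dimK) // phi_a0 mul0r addr0 -mulrzr mulf_neq0 //.
  by rewrite mulrNz oppr_eq0.
- by rewrite mulrC.
- by rewrite r2cube g1 mulr1z.
- by rewrite r1cube g3; ring.
- by rewrite expr2 -mulrA a0r2 mulrDr mulrzAr mulrN a0r1 /nu -/a0; ring.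
by move=> z z'; exists z', z; rewrite addrC.
Qed.
End CaseFour.

(** * The sextics *)

Lemma sextic_eq0 (R : comNzRingType) (m : nat) (a b c : int) (x : R) :
  root (map_poly intr (sextic m a b c)) x -> x ^+ 6 + x ^+ m *~ a + x *~ b + c%:~R = 0.
Proof.
move=> /rootP <-; rewrite /sextic -!mul_polyC !rmorphD !rmorphM /= !map_polyXn map_polyX !map_polyC.
by rewrite !hornerE /= !mulrzl; ring.
Qed.

Lemma sextic_dim (m : nat) (a b c : int) (K : fieldExtType rat) (x : K) : (m < 6)%N ->
  irreducible_poly (map_poly intr (sextic m a b c) : {poly rat}) ->
  root (map_poly intr (sextic m a b c)) x -> <<1; x>>%VS = fullv :> {vspace K} ->
  \dim {:K} = 6%N.
Proof.
move=> m6 [_ irr] rx gx; set F := map_poly intr (sextic m a b c) in irr.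
have sF : size F = 7%N.
  rewrite /F size_map_inj_poly //; last exact: intr_inj.
  rewrite /sextic -!addrA size_polyDl ?size_polyXn //.
  rewrite (leq_ltn_trans (size_polyD _ _)) // gtn_max (leq_ltn_trans (size_scale_leq _ _)) ?size_polyXn //=.
  rewrite (leq_ltn_trans (size_polyD _ _)) // gtn_max (leq_ltn_trans (size_scale_leq _ _)) ?size_polyX //=.
  by rewrite (leq_ltn_trans (size_polyC_leq1 _)).
have /polyOver1P [h Eh] := minPolyOver 1%AS x.
have sh : size h = (adjoin_degree 1 x).+1 by rewrite -size_minPoly Eh size_map_poly.
have hF : h %| F.
  rewrite -(dvdp_map (in_alg K)) /= -Eh.
  have -> : map_poly (in_alg K) F = map_poly intr (sextic m a b c).
    by rewrite -map_poly_comp; apply: eq_map_poly => z; rewrite /= scaler_int.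
  apply: minPoly_dvdp => //.
  by apply/polyOverP=> i; rewrite coef_map rpred_int.
have s1 : size h != 1%N by rewrite sh eqSS -lt0n.
have /eqp_size := irr h s1 hF; rewrite sF sh => /succn_inj d6.
by rewrite -gx dim_Fadjoin dimv1 muln1 d6.
Qed.

Lemma divr_mulz (K : fieldExtType rat) (k : int) (x : K) : k != 0 -> (x / k%:~R) *~ k = x.
Proof. by move=> k0; rewrite -mulrzr divfK // intr_neq0. Qed.

Lemma vp3_factor (b : int) : b != 0 -> exists2 b', b = b' * 3 ^+ vp 3 b & (b'%:~R : 'F_3) != 0.
Proof.
move=> b0; have b1 : (0 < `|b|)%N by rewrite absz_gt0.
have dvdE k : ((3 : int) ^+ k %| b)%Z = (k <= vp 3 b)%N.
  by rewrite dvdzE abszX /vp -pfactor_dvdn.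
have /dvdzP [b' bE] : (3 ^+ vp 3 b %| b)%Z by rewrite dvdE.
exists b' => //; rewrite intF3_eq0; apply/negP => /dvdzP [k kE].
have : ((3 : int) ^+ (vp 3 b).+1 %| b)%Z by apply/dvdzP; exists k; rewrite {1}bE kE exprS mulrA.
by rewrite dvdE ltnn.
Qed.

Lemma vp3_multiple (c : int) n : (n <= vp 3 c)%N -> exists c', c = c' * 3 ^+ n.
Proof.
move=> h; apply/dvdzP; have [->|c0] := eqVneq c 0; first exact: dvdz0.
by rewrite dvdzE abszX pfactor_dvdn ?absz_gt0.
Qed.

(* In each case the elements beyond the powers of th are the Horner quotients f(X) / X ^+ j
   (without negative powers), evaluated at th and divided by the power of 3 which the Newton
   polygon of f has at abscissa j; only zt, for m = 3, comes from the Newton polygon at -1. *)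
Section Sextic.
Context (a b c : int) (K : fieldExtType rat) (th : K) (s : nat) (b' : int).
Context (gth : <<1; th>>%VS = fullv :> {vspace K}) (dimK : \dim {:K} = 6%N).
Context (bE : b = b' * 3 ^+ s) (b'3 : (b'%:~R : 'F_3) != 0).

Lemma sextic_two n a' : th ^+ 6 + th ^+ 2 *~ a + th *~ b + c%:~R = 0 -> a = 9 * a' - 1 ->
  s = n.+1 -> (2 * s < vp 3 c)%N -> vp 3 (field_index K)%:Z = 1%N /\ ~ monogenic K.
Proof.
move=> f0 aE sE /vp3_multiple [c2 cE].
pose P : int := 3 ^+ n; have P0 : P != 0 by rewrite expf_neq0.
have P30 : 3 * P != 0 by rewrite mulf_neq0.
have bP : b = 3 * P * b' by rewrite bE sE exprS mulrC.
(* The strict inequality gives one factor 3 beyond (3 P)^2 = 3^(2 s). *)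
have {}cE : c = 27 * P * P * c2.
  have -> : 27 * P * P = 3 ^+ (2 * s).+1 by rewrite exprS mulnC exprM sE [3 ^+ n.+1]exprS -/P; ring.
  by rewrite mulrC.
pose eta := (th ^+ 5 + th *~ a + b%:~R) / (3 * P)%:~R.
have etaE : eta *~ (3 * P) = th ^+ 5 + th *~ a + b%:~R by apply: divr_mulz.
apply: (@conclusion_two K th eta P b' c2 a' gth dimK P0 b'3).
  by rewrite etaE aE bP; ring.
apply: (cancel_mulz P30); rewrite -mulrzAr etaE.
transitivity (th ^+ 6 + th ^+ 2 *~ a + th *~ b + c%:~R - c%:~R); first by ring.
by rewrite f0 cE; ring.
Qed.

Lemma sextic_three n a' : th ^+ 6 + th ^+ 3 *~ a + th *~ b + c%:~R = 0 -> a = 9 * a' + 1 ->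
  s = n.+1.*2.+1 -> (3 * s < 2 * vp 3 c)%N -> vp 3 (field_index K)%:Z = 1%N /\ ~ monogenic K.
Proof.
(* For s = 2 n + 3, the inequality 3 s < 2 v_3(c) means v_3(c) >= 3 n + 5. *)
move=> f0 aE sE hv; have [|c2 cE] := @vp3_multiple c (3 * n.+1).+2; first by move: hv; rewrite sE; lia.
pose A1 : int := 3 ^+ n; have A10 : A1 != 0 by rewrite expf_neq0.
have A0 : 3 * A1 != 0 by rewrite mulf_neq0.
have A30 : 3 * (3 * A1) != 0 by rewrite mulf_neq0.
have bA : b = 3 * (3 * A1) * (3 * A1) * b'.
  by rewrite bE sE exprS -muln2 exprM [3 ^+ n.+1]exprS -/A1; ring.
have {}cE : c = 9 * (3 * A1) * (3 * A1) * (3 * A1) * c2.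
  by rewrite cE 2!exprS mulnC exprM [3 ^+ n.+1]exprS -/A1; ring.
(* A power of 3 is 1 or 0 modulo 3, never -1; the factor A1 + 1 occurs in the value of mu at the
   ramified prime above 0. *)
have A13 : ((A1 + 1)%:~R : 'F_3) != 0.
  rewrite /A1; case: n {sE hv cE A1 A10 A0 A30 bA} => [|n]; first by rewrite expr0.
  by rewrite exprS intrD intrM F3_three mul0r add0r.
pose d := 1 - a'.
pose u := -1 + 3 * (1 + d); pose t := 1 + 3 * d; pose aa := 1 + 3 * (3 * (1 - d)).
have aaE : a = aa by rewrite aE /aa /d; ring.
(* The numerator factors as th (th + 1)(th + 1 + 3 d). *)
pose zt := (th ^+ 3 + th ^+ 2 *~ u + th *~ t) / (3 : int)%:~R.
have ztE : zt *~ 3 = th ^+ 3 + th ^+ 2 *~ u + th *~ t by apply: divr_mulz.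
pose rho := (th ^+ 4 + th *~ aa) / (3 * A1)%:~R.
have rhoE : rho *~ (3 * A1) = th ^+ 4 + th *~ aa by apply: divr_mulz.
pose eta := th * rho / (3 * (3 * A1))%:~R + b'%:~R.
have etaE : eta *~ (3 * (3 * A1)) = th * rho + (3 * (3 * A1) * b')%:~R.
  by rewrite /eta mulrzDl divr_mulz //; ring.
apply: (@conclusion_three K th zt rho eta A1 b' c2 d gth dimK A10 b'3 A13).
- by rewrite ztE /u /t; ring.
- exact: rhoE.
- by rewrite etaE; ring.
apply: (cancel_mulz A30); rewrite -mulrzAr etaE; apply: (cancel_mulz A0).
transitivity (th ^+ 2 * (rho *~ (3 * A1)) + th *~ (3 * (3 * A1) * (3 * A1) * b')); first by ring.
rewrite rhoE -bA.
transitivity (th ^+ 6 + th ^+ 3 *~ aa + th *~ b + c%:~R - c%:~R); first by ring.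
by rewrite -aaE f0 cE; ring.
Qed.

Lemma sextic_four A B g g' a' c2 : th ^+ 6 + th ^+ 4 *~ a + th *~ b + c%:~R = 0 ->
  a = 9 * a' - 1 -> A != 0 -> g * g' = 3 -> g * A = 3 * B -> g = 1 \/ g = 3 ->
  b = 3 * g * A * A * A * b' -> c = 9 * g * A * A * A * A * c2 ->
  vp 3 (field_index K)%:Z = 1%N /\ ~ monogenic K.
Proof.
move=> f0 aE A0 gg gA g13 bA cE.
have A30 : 3 * A != 0 by rewrite mulf_neq0.
have B30 : 3 * B != 0 by rewrite -gA mulf_neq0 //; case: g13 => ->.
pose r1 := (th ^+ 3 + th *~ (9 * a' - 1)) / A%:~R.
have r1E : r1 *~ A = th ^+ 3 + th *~ (9 * a' - 1) by apply: divr_mulz.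
pose r2 := th * r1 / (3 * B)%:~R.
have r2E : r2 *~ (3 * B) = th * r1 by apply: divr_mulz.
pose eta := th * r2 / (3 * A)%:~R + b'%:~R.
have etaE : eta *~ (3 * A) = th * r2 + (3 * A * b')%:~R.
  by rewrite /eta mulrzDl divr_mulz //; ring.
have E3 : th * r2 = eta *~ (3 * A) - (3 * A * b')%:~R by rewrite etaE; ring.
have E4 : th * eta = - (3 * A * c2)%:~R.
  apply: (cancel_mulz A30); rewrite -mulrzAr etaE; apply: (cancel_mulz B30); apply: (cancel_mulz A0).
  transitivity (th ^+ 2 * (r2 *~ (3 * B)) *~ A + th *~ (3 * A * b' * (3 * B) * A)); first by ring.
  rewrite r2E; transitivity (th ^+ 3 * (r1 *~ A) + th *~ (3 * A * b' * (3 * B) * A)); first by ring.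
  have -> : 3 * A * b' * (3 * B) * A = b by rewrite -gA bA; ring.
  rewrite r1E -aE; transitivity (th ^+ 6 + th ^+ 4 *~ a + th *~ b + c%:~R - c%:~R); first by ring.
  rewrite f0 sub0r cE; transitivity (- ((3 * A * c2) * (3 * A) * (g * A) * A)%:~R : K).
    by ring.
  by rewrite gA; ring.
case: g13 => gE.
  exact: (conclusion_four_1 gth dimK A0 b'3 gg gA r1E (esym r2E) E3 E4 gE).
exact: (conclusion_four_3 gth dimK A0 b'3 gg gA r1E (esym r2E) E3 E4 gE).
Qed.
End Sextic.

Theorem theorem1p4 (m : nat) (a b c : int) (K : fieldExtType rat) (theta : K)
  (hm : m \in [:: 2; 3; 4]%N)
  (hirr : irreducible_poly (map_poly intr (sextic m a b c) : {poly rat}))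
  (hroot : root (map_poly intr (sextic m a b c)) theta)
  (hK : <<1; theta>>%VS = fullv :> {vspace K})
  (ha : (9 %| a + (-1) ^+ m)%Z)
  (hb : (9 %| b)%Z)
  (hc : (9 %| c)%Z)
  (hb0 : b != 0)
  (hv : (m * vp 3 b < (m - 1) * vp 3 c)%N) :
  [/\ m = 2%N -> vp 3 (field_index K)%:Z = 1%N /\ ~ monogenic K,
      m = 3%N -> gcdn (vp 3 b) 2 = 1%N ->
        vp 3 (field_index K)%:Z = 1%N /\ ~ monogenic K
    & m = 4%N -> gcdn (vp 3 b) 3 = 1%N ->
        vp 3 (field_index K)%:Z = 1%N /\ ~ monogenic K].
Proof.
have m6 : (m < 6)%N by move: hm; rewrite !inE => /or3P[] /eqP ->.
have dimK := sextic_dim m6 hirr hroot hK.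
have f0 := sextic_eq0 hroot.
have [b' bE b'3] := vp3_factor hb0.
have s2 : (2 <= vp 3 b)%N.
  by rewrite /vp -pfactor_dvdn ?absz_gt0 //; move: hb; rewrite dvdzE.
have /dvdzP [a' aE] := ha.
split=> mE; rewrite mE in f0 hv aE.
- apply: (@sextic_two a b c K theta (vp 3 b) b' hK dimK bE b'3 (vp 3 b).-1 a' f0).
  + by rewrite mulrC -aE; ring.
  + by rewrite prednK // ltnW.
  by rewrite mul1n in hv.
- move=> cop; have odd_s : odd (vp 3 b).
    by rewrite -[odd _]negbK -dvdn2; apply/negP => /gcdn_idPr; rewrite cop.
  apply: (@sextic_three a b c K theta (vp 3 b) b' hK dimK bE b'3 (vp 3 b)./2.-1 a' f0).
  + by rewrite mulrC -aE; ring.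
  + by rewrite prednK ?half_gt0 // -[LHS]odd_double_half odd_s.
  exact: hv.
move=> cop; set s := vp 3 b in s2 hv cop bE.
have aE' : a = 9 * a' - 1 by rewrite mulrC -aE; ring.
have sE : s = (s %/ 3 * 3 + s %% 3)%N := divn_eq s 3.
set k := (s %/ 3)%N in sE.
have [e|[e|e]] : (s %% 3 = 0 \/ s %% 3 = 1 \/ s %% 3 = 2)%N.
  by have := ltn_pmod s (isT : (0 < 3)%N); case: (s %% 3)%N => [|[|[|]]] //; auto.
- by have : (3 %| s)%N; [rewrite /dvdn e | move/gcdn_idPr; rewrite cop].
- have [|c2 cE] := @vp3_multiple c (4 * k).+2; first by move: hv; rewrite sE e; lia.
  (* 9 divides b, so s = 1 is excluded and B = 3^(k - 1) satisfies A = 3 B. *)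
  have k0 : (0 < k)%N by move: s2; rewrite sE e; lia.
  apply: (sextic_four hK dimK b'3 (A := 3 ^+ k) (B := 3 ^+ k.-1) (g := 1) (g' := 3) (c2 := c2) f0 aE') => //.
  + by rewrite expf_neq0.
  + by rewrite mul1r -exprS prednK.
  + by left.
  + by rewrite bE sE e addn1 exprS exprM; ring.
  by rewrite cE 2!exprS mulnC exprM; ring.
have [|c2 cE] := @vp3_multiple c (4 * k).+3; first by move: hv; rewrite sE e; lia.
apply: (sextic_four hK dimK b'3 (A := 3 ^+ k) (B := 3 ^+ k) (g := 3) (g' := 1) (c2 := c2) f0 aE') => //.
+ by rewrite expf_neq0.
+ by right.
+ by rewrite bE sE e addn2 2!exprS exprM; ring.
by rewrite cE 3!exprS mulnC exprM; ring.
Qed.
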